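(* Let $k,j$ be positive integers with $j\le k$. For $p,\lambda\in[0,1]$ let $$g_p(\lambda):=p\sum_{i=k-j+1}^{k}\binom{k}{i}\lambda^i(1-\lambda)^{k-i}$$ and define $$\tilde p:=\sup\{p\in[0,1]:\ \lambda=0 \text{ is the unique fixed point of } g_p \text{ in } [0,1]\}.$$ Let $p_c$ and $\bar p_c$ be the critical densities of the FA-jf model on $\mathbb{T}^k$ and of the OFA-jf model on $\bar{\mathbb{T}}^k$, respectively. Then $p_c=\bar p_c=\tilde p$, and for every $p<\tilde p$ (with $p\in[0,1]$) the value $0$ is a simple eigenvalue of both generators $\mathcal{L}$ and $\bar{\mathcal{L}}$ at density $p$. Moreover $\tilde p\in(0,1)$ if and only if $2\le j\le k$.
   Context: $\mathbb{T}^k$ is the infinite regular unrooted tree in which every vertex has exactly $k+1$ neighbors. $\bar{\mathbb{T}}^k$ is the infinite rooted $k$-ary tree: the root $r$ has $k$ children (and no ancestor), and every other vertex has $k$ children and one ancestor (parent). For a vertex $x$, $\mathcal{N}_x$ is the set of its neighbors, and, in the rooted case, $\mathcal{K}_x$ is the set of its children. Let $V$ be the vertex set of the tree under consideration, $\Omega=\{0,1\}^V$ (value $1$ = occupied, $0$ = empty). For $p\in[0,1]$ let $\mu=\bigotimes_{x\in V}\mu_x$ be the product measure on $\Omega$ with $\mu_x(1)=p$, $\mu_x(0)=q=1-p$. For a local function $f:\Omega\to\mathbb{R}$ (depending on finitely many variables), $\mu_x(f)(\omega)$ denotes the average of $f$ over the variable at $x$ with respect to $\mu_x$, the other variables being fixed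 equal to those of $\omega$. The FA-jf model on $\mathbb{T}^k$ and the OFA-jf model on $\bar{\mathbb{T}}^k$ at density $p$ are the continuous time Markov processes on $\Omega$, reversible with respect to $\mu$, whose generators act on local functions as $$\mathcal{L}f(\omega)=\sum_{x\in\mathbb{T}^k}c_x(\omega)[\mu_x(f)(\omega)-f(\omega)],\qquad \bar{\mathcal{L}}f(\omega)=\sum_{x\in\bar{\mathbb{T}}^k}\bar c_x(\omega)[\mu_x(f)(\omega)-f(\omega)],$$ where $c_x(\omega)=1$ if $\sum_{y\in\mathcal{N}_x}(1-\omega_y)\ge j$ and $c_x(\omega)=0$ otherwise, and $\bar c_x(\omega)=1$ if $\sum_{y\in\mathcal{K}_x}(1-\omega_y)\ge j$ and $\bar c_x(\omega)=0$ otherwise. These generators extend to non-positive self-adjoint operators on $L^2(\Omega,\mu)$, still denoted $\mathcal{L},\bar{\mathcal{L}}$. The critical densities are $$p_c=\sup\{p\in[0,1):\ 0\text{ is a simple eigenvalue of }\mathcal{L}\},\qquad \bar p_c=\sup\{p\in[0,1):\ 0\text{ is a simple eigenvalue of }\bar{\mathcal{L}}\}.$$ *)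

(* Defs.v *)
From HB Require Import structures.
From mathcomp Require Import all_boot all_order all_algebra.
From mathcomp Require Import all_classical all_reals all_analysis.
From mathcomp Require Import ring lra.

Set Implicit Arguments.
Unset Strict Implicit.
Unset Printing Implicit Defensive.

Import Order.TTheory GRing.Theory Num.Theory.
Import numFieldNormedType.Exports.

Local Open Scope classical_set_scope.
Local Open Scope ring_scope.

Section Configurations.
Context (V : countType).

Definition coordinate_events : set (set (V -> bool)) :=
  [set [set w : V -> bool | w x] | x in [set: V]].

(* {0,1}^V with the product sigma-algebra; [true] is 1 (occupied). *)
Definition config := g_sigma_algebraType coordinate_events.

End Configurations.

Section ProductMeasure.
Context (R : realType) (V : countType).

Definition spin_weight (p : R) (b : bool) : R := if b then p else 1 - p.

Definition is_bernoulli_product (p : R) (mu : probability (config V) R) :=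
  forall (s : seq V) (b : V -> bool), uniq s ->
    mu [set w : config V | {in s, w =1 b}] =
    (\prod_(x <- s) spin_weight p (b x))%:E.

(* The cylinders form a generating pi-system, so this determines the measure;
   for 0 <= p <= 1 it exists ([bernoulli_productP]). The value is irrelevant
   for other p. *)
Definition bernoulli_product (p : R) : probability (config V) R :=
  get [set mu | is_bernoulli_product p mu].

End ProductMeasure.

(* The product measure is the image of the uniform law on [0,1[ under the
   expansion of u whose digits are read off by the piecewise affine map that
   sends [0,p[ and [p,1[ onto [0,1[. *)
Section BernoulliProductExistence.
Context (R : realType) (p : R).
Hypothesis p01 : 0 <= p <= 1.
Let leb := @lebesgue_measure R.

Let shift (u : R) := if u < p then u / p else (u - p) / (1 - p).

Let coin n u := iter n shift u < p.

Let wt (o : option bool) : R := if o is Some b then spin_weight p b else 1.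

Let Fixpoint in_word (w : seq (option bool)) (u : R) : bool :=
  if w is o :: w' then
    [&& 0 <= u < 1, (if o is Some b then (u < p) == b else true)
      & in_word w' (shift u)]
  else 0 <= u < 1.

Let shift01 u : 0 <= u < 1 -> 0 <= shift u < 1.
Proof.
move=> /andP[u0 u1]; rewrite /shift; case: ltP => [up|pu].
  have p0 : 0 < p by exact: le_lt_trans up.
  by rewrite divr_ge0 ?(ltW p0)//= ltr_pdivrMr// mul1r.
have p1 : 0 < 1 - p by rewrite subr_gt0 (le_lt_trans pu).
by rewrite divr_ge0 ?subr_ge0 ?(ltW p1)// ?ltr_pdivrMr ?mul1r ?ltrD2r//
  -subr_ge0 (ltW p1).
Qed.

Let in_word_itv (v : seq bool) : exists a l : R,
  [/\ 0 <= a, 0 <= l, a + l <= 1, l = \prod_(b <- v) spin_weight p b &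
   forall u, in_word (map Some v) u = (a <= u < a + l)].
Proof.
elim: v => [|b v [a [l [a0 l0 al lE Hv]]]].
  by exists 0, 1; rewrite big_nil add0r; split.
case/andP: p01 => p0 p1.
have q0 : 0 <= 1 - p by rewrite subr_ge0.
case: b.
  exists (p * a), (p * l); rewrite big_cons -lE; split => //.
  - exact: mulr_ge0.
  - exact: mulr_ge0.
  - by rewrite -mulrDr mulr_ile1// addr_ge0.
  move=> u /=; rewrite Hv eqb_id /shift -mulrDr.
  case: (ltP u p) => up /=; last first.
    rewrite andbF; apply/esym/negbTE/negP => /andP[_ h].
    have : p * (a + l) <= p by rewrite ler_piMr.
    by lra.
  have [u0|u0] := ltP u 0 => /=.
    apply/esym/negbTE/negP => /andP[h _].
    have : 0 <= p * a by exact: mulr_ge0.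
    by lra.
  have pp : 0 < p := le_lt_trans u0 up.
  rewrite (lt_le_trans up p1)/= ler_pdivlMr// ltr_pdivrMr//.
  by rewrite ![_ * p]mulrC.
exists (p + (1 - p) * a), ((1 - p) * l); rewrite big_cons -lE; split => //.
- by rewrite addr_ge0// mulr_ge0.
- exact: mulr_ge0.
- rewrite -addrA -mulrDr.
  have : (1 - p) * (a + l) <= 1 - p by rewrite ler_piMr.
  by lra.
move=> u /=; rewrite Hv eqbF_neg /shift -leNgt -addrA -mulrDr.
case: (ltP u p) => up /=.
  rewrite andbF; apply/esym/negbTE/negP => /andP[h _].
  have : 0 <= (1 - p) * a by exact: mulr_ge0.
  by lra.
have [u1|u1] := ltP u 1 => /=; last first.
  rewrite andbF; apply/esym/negbTE/negP => /andP[_ h].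
  have : (1 - p) * (a + l) <= 1 - p by rewrite ler_piMr.
  by lra.
have pp : 0 < 1 - p by rewrite subr_gt0 (le_lt_trans up).
rewrite (le_trans p0 up)/= ler_pdivlMr// ltr_pdivrMr//.
by rewrite ![_ * (1 - p)]mulrC lerBrDl ltrBlDl.
Qed.

Let in_word_None (v : seq (option bool)) w u :
  in_word (v ++ None :: w) u =
  in_word (v ++ Some true :: w) u || in_word (v ++ Some false :: w) u.
Proof.
elim: v u => [|o v IH] u /=.
  by case: (_ <= _ < _); case: (u < p); case: in_word.
by rewrite IH andb_orr andb_orr.
Qed.

Let in_word_disj (v : seq (option bool)) w u :
  in_word (v ++ Some true :: w) u -> ~~ in_word (v ++ Some false :: w) u.
Proof.
elim: v u => [|o v IH] u /=; first by case: (u < p); rewrite ?andbF.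
by case/and3P => _ _ /IH; rewrite !negb_and => ->; rewrite !orbT.
Qed.

Let in_word_measure (v : seq bool) w :
  measurable [set u : R | in_word (map Some v ++ w) u] /\
  leb [set u | in_word (map Some v ++ w) u] =
  (\prod_(b <- v) spin_weight p b * \prod_(o <- w) wt o)%:E.
Proof.
elim: w v => [|o w IH] v.
  rewrite cats0 big_nil mulr1.
  have [a [l [a0 l0 _ <- H]]] := in_word_itv v.
  have -> : [set u | in_word (map Some v) u] = `[a, (a + l)[%classic.
    by apply/seteqP; split => u /=; rewrite H in_itv.
  split; first exact: measurable_itv.
  rewrite /leb lebesgue_measure_itv/= lte_fin ltrDl -EFinB addrAC subrr add0r.
  by case: ltP => // l0'; congr EFin; apply/eqP; rewrite eq_le l0 l0'.
case: o => [b|].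
  by have := IH (rcons v b); rewrite map_rcons -cats1 -catA/= -cats1 big_cat
    big_seq1 big_cons mulrA.
have [mt lt] := IH (rcons v true).
have [mf lf] := IH (rcons v false).
move: mt mf lt lf; rewrite !map_rcons -!cats1 -!catA/= !big_cat !big_seq1/=.
set A := [set u | in_word (_ ++ Some true :: _) u].
set B := [set u | in_word (_ ++ Some false :: _) u].
move=> mA mB lA lB.
have -> : [set u | in_word (map Some v ++ None :: w) u] = A `|` B.
  by apply/seteqP; split => u /=; rewrite in_word_None => /orP.
split; first exact: measurableU.
rewrite /leb measureU//; last first.
  apply/seteqP; split => // u [/= h]; rewrite /B/=.
  by apply/negP/in_word_disj.
by rewrite [X in (X + _)%E]lA [X in (_ + X)%E]lB -EFinD big_cons/=; congr EFin; ring.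
Qed.

Let in_wordP w u :
  reflect (0 <= u < 1 /\
    forall n, (n < size w)%N -> if nth None w n is Some b then coin n u = b else True)
  (in_word w u).
Proof.
apply: (iffP idP).
  elim: w u => [|o w IH] u /=; first by [].
  case/and3P => -> ob /IH[_ H]; split => // -[_|n] /=.
    by case: o ob => // b /eqP.
  by rewrite ltnS => /H; rewrite /coin iterSr.
elim: w u => [|o w IH] u /= [u01 H] //.
rewrite u01 /=; apply/andP; split.
  by have := H 0%N isT; case: (o) => //= b; rewrite /coin/= => ->.
by apply: IH; split => [|n nw]; [exact: shift01|have := H n.+1 nw; rewrite /coin iterSr].
Qed.

Context (V : countType).

Let sample (u : measurableTypeR R) : config V := fun x => (0 <= u < 1) && coin (pickle x) u.

Let measurable_sample :
  @measurable_fun _ _ (measurableTypeR R) (config V) setT sample.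
Proof.
apply: (@measurability _ _ _ (config V) setT sample (@coordinate_events V)) => //.
move=> _ [_ [x _ <-] <-]; rewrite setTI.
have [m _] := in_word_measure [::] (rcons (nseq (pickle x) None) (Some true)).
set S := (X in measurable X).
have -> : S = [set u | in_word ([::] ++ rcons (nseq (pickle x) None) (Some true)) u]; last exact: m.
rewrite {}/S; apply/seteqP; split => u /=.
  case/andP => u01 ux; apply/in_wordP; split => // n.
  rewrite size_rcons size_nseq nth_rcons size_nseq nth_nseq ltnS => nx.
  by case: ltngtP nx => // -> _; rewrite ux.
case/in_wordP => u01 /(_ (pickle x)).
rewrite size_rcons size_nseq nth_rcons size_nseq ltnn eqxx ltnS leqnn => /(_ isT).
by rewrite /sample u01 => ->.
Qed.

HB.instance Definition _ := @isMeasurableFun.Build _ _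
  (measurableTypeR R) (config V) sample measurable_sample.

Let m01 : measurable (`[0, 1[%classic : set R).
Proof. exact: measurable_itv. Qed.

Let unif := mrestr leb m01.

Let unifT : unif setT = 1%E.
Proof.
rewrite /unif /mrestr setTI /leb lebesgue_measure_itv/=.
by rewrite lte_fin ltr01 oppr0 adde0.
Qed.

HB.instance Definition _ := Measure.on unif.
HB.instance Definition _ := @Measure_isProbability.Build _ _ _ unif unifT.

Lemma bernoulli_product_exists :
  exists mu : probability (config V) R, is_bernoulli_product p mu.
Proof.
exists (distribution unif
  (sample : {mfun measurableTypeR R >-> config V})) => s b us.
pose ow n := if pickle_inv n is Some x then
  (if x \in s then Some (b x) else None) else (None : option bool).
pose N := (\max_(x <- s) pickle x).+1.
have sN x : x \in s -> (pickle x < N)%N.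
  by move=> xs; rewrite ltnS (leq_bigmax_seq _ xs).
have owx x : ow (pickle x) = if x \in s then Some (b x) else None.
  by rewrite /ow pickleK_inv.
have [_ +] := in_word_measure [::] (mkseq ow N).
rewrite big_nil mul1r big_map => H.
transitivity (\prod_(n <- iota 0 N) wt (ow n))%:E.
  rewrite -H /distribution /pushforward /= /unif /mrestr; congr (leb _).
  apply/seteqP; split => u.
    case=> /= sb; rewrite in_itv/= => u01.
    change (in_word (mkseq ow N) u); apply/in_wordP; split => // n.
    rewrite size_mkseq => nN; rewrite nth_mkseq//.
    case E : (ow n) => [c|//]; move: E; rewrite /ow.
    case E : (pickle_inv n) => [x|//]; case: ifPn => // xs [<-].
    have := @pickle_invK V n; rewrite E/= => <-.
    by have := sb _ xs; rewrite /sample u01.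
  move=> h; change (is_true (in_word (mkseq ow N) u)) in h.
  case/in_wordP: h => u01 h; split; last by rewrite /= in_itv.
  move=> x xs; have := h (pickle x); rewrite size_mkseq => /(_ (sN _ xs)).
  by rewrite nth_mkseq ?sN// owx xs /sample u01 => ->.
congr EFin.
rewrite (bigID (fun n => n \in map pickle s))/= [X in _ * X]big1 ?mulr1; last first.
  move=> n ns; rewrite /ow; case E : (pickle_inv n) => [x|//].
  case: ifPn => // xs; case/negP: ns; apply/mapP; exists x => //.
  by have := @pickle_invK V n; rewrite E.
rewrite -[0%N :: _]/(iota 0 N) -big_filter (perm_big (map pickle s)).
  by rewrite big_map; apply: eq_big_seq => x xs; rewrite owx xs.
apply: uniq_perm; first by rewrite filter_uniq// iota_uniq.
  by rewrite (map_inj_uniq (pcan_inj pickleK)).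
move=> n; rewrite mem_filter mem_iota add0n /= andb_idr// => /mapP[x xs ->].
exact: sN.
Qed.

Lemma bernoulli_productP : is_bernoulli_product p (bernoulli_product V p).
Proof.
have [mu mup] := bernoulli_product_exists.
exact: (@getPex _ [set mu | is_bernoulli_product p mu] (ex_intro _ mu mup)).
Qed.

End BernoulliProductExistence.

Section L2Operators.
Context d (T : measurableType d) (R : realType).
Variable mu : {measure set T -> \bar R}.

Definition L2_cvg (u : nat -> T -> R) (f : T -> R) :=
  'N[mu]_2%:E[EFin \o (u n \- f)%R]%E @[n --> \oo] --> 0%E.

(* Graph of the closure in L^2(mu) of the operator A with domain D. *)
Definition L2_closure (D : set (T -> R)) (A : (T -> R) -> (T -> R))
    (f g : T -> R) :=
  [/\ f \in Lfun mu 2%:E, g \in Lfun mu 2%:E &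
      exists u : nat -> T -> R,
        [/\ forall n, D (u n), L2_cvg u f & L2_cvg (fun n => A (u n)) g]].

(* G is the graph of an operator on L^2(mu), whose elements are represented by
   functions up to mu-a.e. equality: the eigenspace of l is a line. *)
Definition simple_eigenvalue (G : (T -> R) -> (T -> R) -> Prop) (l : R) :=
  exists e : T -> R,
    [/\ G e (l \*: e), ~ (e = cst 0 %[ae mu]) &
        forall f, G f (l \*: f) -> exists c : R, f = c \*: e %[ae mu]].

End L2Operators.

Section Generator.
Context (R : realType) (V : countType).
(* [N x] lists without repetition the vertices entering the constraint at x. *)
Variables (N : V -> seq V) (j : nat).

Definition local_function (f : config V -> R) :=
  exists S : seq V, forall w w' : config V, {in S, w =1 w'} -> f w = f w'.

Definition set_spin (w : config V) (x : V) (b : bool) : config V :=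
  fun y => if y == x then b else w y.

Definition site_average (p : R) (x : V) (f : config V -> R) (w : config V) : R :=
  p * f (set_spin w x true) + (1 - p) * f (set_spin w x false).

Definition constraint (x : V) (w : config V) : bool :=
  (j <= \sum_(y <- N x) (1 - w y))%N.

(* For local f only finitely many terms are nonzero. *)
Definition generator (p : R) (f : config V -> R) (w : config V) : R :=
  \sum_(x \in [set: V])
    (constraint x w)%:R * (site_average p x f w - f w).

(* Local functions are a core of the Feller generator, so the operator they
   carry is essentially self-adjoint on L^2: its closure is the self-adjoint
   extension. *)
Definition generator_L2 (p : R) : (config V -> R) -> (config V -> R) -> Prop :=
  L2_closure (bernoulli_product V p) local_function (generator p).

Definition zero_simple_eigenvalue (p : R) :=
  simple_eigenvalue (bernoulli_product V p) (generator_L2 p) 0.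

Definition critical_density : R :=
  sup [set p : R | 0 <= p < 1 /\ zero_simple_eigenvalue p].

End Generator.

(* The rooted k-ary tree: the root is the empty word and the children of x are
   the words i :: x with i < k. *)
Definition rooted_tree (k : nat) : countType := seq 'I_k.

Definition children (k : nat) (x : rooted_tree k) : seq (rooted_tree k) :=
  [seq i :: x | i <- enum 'I_k].

Section RegularTree.
Context (k : nat).

Definition reduced (s : seq 'I_k.+1) : bool := sorted (fun a b => a != b) s.

(* The (k+1)-regular tree, as the Cayley graph of the free product of k+1
   copies of Z/2: vertices are the words without two equal consecutive letters,
   and the neighbor of x along the letter a is the reduction of a :: x. *)
Definition regular_tree : countType := {s : seq 'I_k.+1 | reduced s}.

Definition reduced_cons (a : 'I_k.+1) (s : seq 'I_k.+1) : seq 'I_k.+1 :=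
  if s is b :: t then if a == b then t else a :: s else [:: a].

Lemma reduced_consP a s : reduced s -> reduced (reduced_cons a s).
Proof.
case: s => [|b t] //= bt; case: eqVneq => [_|ab] /=; last by rewrite ab.
exact: path_sorted bt.
Qed.

Definition neighbor (x : regular_tree) (a : 'I_k.+1) : regular_tree :=
  exist _ (reduced_cons a (val x)) (reduced_consP a (valP x)).

Definition neighbors (x : regular_tree) : seq regular_tree :=
  [seq neighbor x a | a <- enum 'I_k.+1].

Lemma size_neighbors x : size (neighbors x) = k.+1.
Proof. by rewrite size_map size_enum_ord. Qed.

Lemma neighbor_inj x : injective (neighbor x).
Proof.
case: x => -[|c t] rs a b /(congr1 val)/=; first by case.
case: (eqVneq a c) (eqVneq b c) => [->|_] [->|_] //.
- by move=> /(congr1 size)/= /eqP; rewrite -addn2 -[X in X == _]addn0 eqn_add2l.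
- by move=> /(congr1 size)/= /eqP; rewrite -addn2 -[X in _ == X]addn0 eqn_add2l.
- by case.
Qed.

Lemma uniq_neighbors x : uniq (neighbors x).
Proof. by rewrite (map_inj_uniq (@neighbor_inj x)) enum_uniq. Qed.

Lemma neighborK x a : neighbor (neighbor x a) a = x.
Proof.
apply: val_inj; case: x => -[|c t] rs /=; first by rewrite eqxx.
case: eqVneq => [->|ac] /=; last by rewrite eqxx.
by case: t rs => [|d t] //= /andP[/negbTE ->].
Qed.

End RegularTree.

Section Models.
Context (R : realType) (k j : nat).

Definition FA_zero_simple (p : R) :=
  zero_simple_eigenvalue (@neighbors k) j p.

Definition OFA_zero_simple (p : R) :=
  zero_simple_eigenvalue (@children k) j p.

Definition FA_critical_density : R := critical_density R (@neighbors k) j.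

Definition OFA_critical_density : R := critical_density R (@children k) j.

Definition branching_map (p l : R) : R :=
  p * \sum_(k - j + 1 <= i < k.+1) 'C(k, i)%:R * l ^+ i * (1 - l) ^+ (k - i).

Definition ptilde : R :=
  sup [set p : R | 0 <= p <= 1 /\
                   [set l : R | 0 <= l <= 1 /\ branching_map p l = l] = [set 0]].

End Models.

(* Main.v *)
(* Let h(l) be the probability that fewer than j of k kids are empty when each
   is occupied with probability l, so that g_p = p h. Declare all sites n
   generations below a vertex blocked, and going up declare a site blocked if it
   is occupied and fewer than j of its kids are not blocked. Then the vertex is
   blocked with probability l_n = g_p^n(1), which decreases to the largest fixed
   point of g_p.

   For p below the threshold l_n tends to 0, so almost surely at least j kids of
   any vertex x can be emptied by legal flips below x. A function in the kernel
   has zero Dirichlet form, hence is invariant under legal flips, hence under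
   the flip at x by running such a sequence of flips forth and back. It is
   constant by comparison with the local functions that approximate it.

   For p above the threshold the event that the root and its kids are blocked
   forever has probability in (0,1). Applied to the indicator of its
   approximation up to generation n, the generator only sees the boundary sites
   that are pivotal: legal flips in the interior do not matter. Their number has
   a second moment tending to 0, because g_p' < 1 at the largest fixed point l:
   h(l) / (l h'(l)) is nondecreasing, so g_p'(l) >= 1 would make h(x)/x
   nondecreasing up to l, and no smaller p could have a positive fixed point.

   On both trees the constraint at a vertex only involves its kids and possibly
   its parent, so one argument covers them. *)
From HB Require Import structures.
Require Import Defs.
From mathcomp Require Import all_boot all_order all_algebra.
From mathcomp Require Import all_classical all_reals all_analysis.
From mathcomp Require Import measurable_realfun zify ring lra.

Set Implicit Arguments.
Unset Strict Implicit.
Unset Printing Implicit Defensive.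

Import Order.TTheory GRing.Theory Num.Theory.
Import numFieldNormedType.Exports.

Local Open Scope classical_set_scope.
Local Open Scope ring_scope.

(** * The branching map *)

Section BinomialTail.
Context (R : realType).
Implicit Types (p l : R) (k m : nat).

(* The probability that fewer than [m] of [k] independent trials fail, each
   succeeding with probability [l]. *)
Definition binomial_tail k m l : R :=
  \sum_(f < m) 'C(k, f)%:R * l ^+ (k - f) * (1 - l) ^+ f.

Lemma binomial_tail0 m l : binomial_tail 0 m l = (0 < m)%N%:R.
Proof.
case: m => [|m]; rewrite /binomial_tail ?big_ord0// big_ord_recl big1 ?addr0.
  by rewrite bin0 !expr0 !mulr1.
by move=> i _; rewrite bin0n !mul0r.
Qed.

(** Conditioning on one trial. At [m = 0] both sides are empty sums, so the truncated [m.-1] is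
    harmless. *)
Lemma binomial_tailS k m l :
  binomial_tail k.+1 m l =
  l * binomial_tail k m l + (1 - l) * binomial_tail k m.-1 l.
Proof.
case: m => [|m]; first by rewrite /binomial_tail !big_ord0 !mulr0 addr0.
rewrite /binomial_tail big_ord_recl [in RHS]big_ord_recl/= mulrDr -addrA !mulr_sumr.
congr (_ + _); first by rewrite !bin0 !subn0 !expr0 exprS; ring.
rewrite -big_split/=; apply: eq_bigr => i _.
rewrite /bump/= add1n binS natrD subSS.
have [ik|ki] := ltnP i k; last by rewrite bin_small// (exprS (1 - l)); ring.
by rewrite -(subnSK ik) !exprS; ring.
Qed.

Lemma binomial_tail_recr k m l :
  binomial_tail k m.+1 l =
  binomial_tail k m l + 'C(k, m)%:R * l ^+ (k - m) * (1 - l) ^+ m.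
Proof. exact: big_ord_recr. Qed.

(** Counting the [k - i] failures instead of the [i] successes reverses the sum and turns an upper
    tail into a lower one. *)
Lemma branching_mapE k j p l : (j <= k)%N ->
  branching_map k j p l = p * binomial_tail k j l.
Proof.
move=> jk; rewrite /branching_map /binomial_tail; congr (_ * _).
rewrite big_nat_rev/= -{1}[(k - j + 1)%N]add0n big_addn.
have -> : (k.+1 - (k - j + 1) = j)%N by rewrite addn1 subSS subKn.
rewrite big_mkord; apply: eq_bigr => i _.
have ik : (i <= k)%N by rewrite (leq_trans (ltnW (ltn_ord i))).
have -> : ((k - j + 1) + k.+1 - (i + (k - j + 1)).+1 = k - i)%N.
  by rewrite -addSn addnC subnDr subSS.
by rewrite bin_sub// subKn.
Qed.

Lemma binomial_tail_ge0 k m l : 0 <= l <= 1 -> 0 <= binomial_tail k m l.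
Proof.
move=> /andP[l0 l1]; apply: sumr_ge0 => i _.
by rewrite mulr_ge0 ?exprn_ge0 ?subr_ge0// mulr_ge0 ?exprn_ge0.
Qed.

Lemma binomial_tail_leW k m n l : 0 <= l <= 1 -> (m <= n)%N ->
  binomial_tail k m l <= binomial_tail k n l.
Proof.
move=> /andP[l0 l1] mn; rewrite -(subnK mn).
elim: (n - m)%N => [|d IH]; first by rewrite add0n.
rewrite addSn binomial_tail_recr (le_trans IH)// lerDl.
by rewrite mulr_ge0 ?exprn_ge0 ?subr_ge0// mulr_ge0 ?exprn_ge0.
Qed.

Lemma binomial_tail_le1 k m l : 0 <= l <= 1 -> binomial_tail k m l <= 1.
Proof.
move=> l01; have /andP[l0 l1] := l01; elim: k m => [|k IH] m.
  by rewrite binomial_tail0; case: (0 < m)%N => /=.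
rewrite binomial_tailS.
have h1 := IH m; have h2 := IH m.-1.
have : 0 <= l * (1 - binomial_tail k m l) by rewrite mulr_ge0// subr_ge0.
have : 0 <= (1 - l) * (1 - binomial_tail k m.-1 l) by rewrite mulr_ge0// subr_ge0.
by lra.
Qed.

(** In [binomial_tailS], raising [l] moves weight from the tail at [m.-1] to the larger tail at
    [m]. *)
Lemma binomial_tail_homo k m : {in `[0, 1] &, {homo binomial_tail k m : a b / a <= b}}.
Proof.
move=> a b; rewrite !in_itv/= => a01 b01 ab; have /andP[a0 a1] := a01; have /andP[b0 b1] := b01.
elim: k m => [|k IH] m; first by rewrite !binomial_tail0.
rewrite !binomial_tailS.
have h1 := IH m; have h2 := IH m.-1.
have h3 := binomial_tail_leW k b01 (leq_pred m).
have : 0 <= a * (binomial_tail k m b - binomial_tail k m a) by rewrite mulr_ge0// subr_ge0.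
have : 0 <= (1 - a) * (binomial_tail k m.-1 b - binomial_tail k m.-1 a)
  by rewrite mulr_ge0// subr_ge0.
have : 0 <= (b - a) * (binomial_tail k m b - binomial_tail k m.-1 b) by rewrite mulr_ge0// subr_ge0.
by lra.
Qed.

(* [k] times the probability that exactly [m.-1] of [k.-1] trials fail. *)
Definition dbinomial_tail k m l : R :=
  k%:R * (binomial_tail k.-1 m l - binomial_tail k.-1 m.-1 l).

Lemma is_derive_binomial_tail k m l :
  is_derive l 1 (binomial_tail k m) (dbinomial_tail k m l).
Proof.
elim: k m => [|k IH] m.
  have -> : binomial_tail 0 m = cst ((0 < m)%N%:R).
    by apply/funext => x; rewrite binomial_tail0.
  by rewrite /dbinomial_tail mul0r; exact: is_derive_cst.
have -> : binomial_tail k.+1 m =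
    id * binomial_tail k m + (cst 1 - id) * binomial_tail k m.-1.
  by apply/funext => x; rewrite binomial_tailS.
apply: is_derive_eq.
have -> : (cst 1 - id : R -> R) l = 1 - l by [].
rewrite /dbinomial_tail /= /GRing.scale/=.
case: k {IH} => [|k] /=; first by rewrite !binomial_tail0; ring.
rewrite !(binomial_tailS k) -!natr1.
by ring.
Qed.

Lemma continuous_binomial_tail k m : continuous (binomial_tail k m).
Proof.
move=> l; apply: differentiable_continuous; apply/derivable1_diffP.
by have [] := is_derive_binomial_tail k m l.
Qed.

Lemma dbinomial_tailE k m l :
  dbinomial_tail k.+1 m.+1 l = k.+1%:R * ('C(k, m)%:R * l ^+ (k - m) * (1 - l) ^+ m).
Proof. by rewrite /dbinomial_tail/= binomial_tail_recr addrC addKr. Qed.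

Lemma dbinomial_tail_ge0 k m l : 0 <= l <= 1 -> 0 <= dbinomial_tail k m l.
Proof.
by move=> l01; rewrite mulr_ge0// subr_ge0 binomial_tail_leW// leq_pred.
Qed.

(* Termwise, [binomial_tail l / (l * dbinomial_tail l)] is a combination of
   nonnegative powers of [l / (1 - l)]. *)
Lemma binomial_tail_dratio k m a b : (0 < m <= k)%N -> 0 <= a <= b -> b <= 1 ->
  binomial_tail k m a * (b * dbinomial_tail k m b) <=
  binomial_tail k m b * (a * dbinomial_tail k m a).
Proof.
case: k m => [|k] [|m]//=; rewrite ltnS => mk /andP[a0 ab] b1.
have b0 : 0 <= b by rewrite (le_trans a0).
have a1 : a <= 1 by rewrite (le_trans ab).
rewrite !dbinomial_tailE.
have E l : l * (k.+1%:R * ('C(k, m)%:R * l ^+ (k - m) * (1 - l) ^+ m)) =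
  (k.+1%:R * 'C(k, m)%:R) * (l ^+ (k.+1 - m) * (1 - l) ^+ m).
  by rewrite subSn// exprS; ring.
rewrite !E; set c := k.+1%:R * _; have c0 : 0 <= c by rewrite mulr_ge0.
rewrite !(mulrCA _ c) ler_wpM2l//.
rewrite /binomial_tail !mulr_suml ler_sum// => -[f fm] _ /=.
rewrite -!mulrA !ler_wpM2l//.
rewrite ltnS in fm; have fk := leq_trans fm mk.
have -> : (k.+1 - f = (k.+1 - m) + (m - f))%N.
  by rewrite addnBA// subnK// leqW.
have X l : (1 - l) ^+ m = (1 - l) ^+ (m - f) * (1 - l) ^+ f by rewrite -exprD subnK.
rewrite !X {X}.
set d := (m - f)%N; set e := (_ - _)%N; rewrite !exprD.
have -> : a ^+ e * a ^+ d * ((1 - a) ^+ f * (b ^+ e * ((1 - b) ^+ d * (1 - b) ^+ f)))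
  = (a ^+ e * (1 - a) ^+ f * b ^+ e * (1 - b) ^+ f) * (a * (1 - b)) ^+ d.
  by rewrite exprMn; ring.
have -> : b ^+ e * b ^+ d * ((1 - b) ^+ f * (a ^+ e * ((1 - a) ^+ d * (1 - a) ^+ f)))
  = (a ^+ e * (1 - a) ^+ f * b ^+ e * (1 - b) ^+ f) * (b * (1 - a)) ^+ d.
  by rewrite exprMn; ring.
(* After removing the common nonnegative factor, what remains is the [d]-th power of
   [a * (1 - b) <= b * (1 - a)], that is, of [a <= b]. *)
rewrite ler_wpM2l//.
  by rewrite !mulr_ge0 ?exprn_ge0 ?subr_ge0.
by apply: lerXn2r; rewrite ?nnegrE ?mulr_ge0 ?subr_ge0//; lra.
Qed.

End BinomialTail.

(** * Fixed points of the branching map and bounds on the threshold *)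

Section BranchingDynamics.
Context (R : realType) (k j : nat).
Hypotheses (j_gt0 : (0 < j)%N) (jk : (j <= k)%N).
Implicit Types (p l : R).

Let h : R -> R := binomial_tail k j.

(** The iterates [g_p^n(1)]; [expect_blocked] identifies them with blocking probabilities. *)
Definition occupation p n : R := iter n (fun l => p * binomial_tail k j l) 1.

Lemma binomial_tail_at0 : h 0 = 0.
Proof.
rewrite /h /binomial_tail big1// => -[i ij] _ /=.
by rewrite expr0n subn_eq0 leqNgt (leq_trans ij jk)/= mulr0 mul0r.
Qed.

Lemma occupation01 p n : 0 <= p <= 1 -> 0 <= occupation p n <= 1.
Proof.
move=> /andP[p0 p1]; elim: n => [|n IH]; first by rewrite /= ler01 lexx.
have h0 := binomial_tail_ge0 k j IH; have h1 := binomial_tail_le1 k j IH.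
by rewrite /= mulr_ge0//= mulr_ile1.
Qed.

(** Monotonicity keeps the orbit of [1] above every [l] with [l <= g_p(l)]; its limit is therefore
    the largest such point. *)
Lemma le_occupation p l n : 0 <= p <= 1 -> 0 <= l <= 1 -> l <= p * h l ->
  l <= occupation p n.
Proof.
move=> p01 /[dup] l01 /andP[l0 l1] lh; have /andP[p0 p1] := p01.
elim: n => [|n IH] //=; apply: (le_trans lh); rewrite ler_wpM2l//.
by apply: binomial_tail_homo; rewrite ?in_itv//= occupation01.
Qed.

Lemma occupation_nonincreasing p : 0 <= p <= 1 -> nonincreasing_seq (occupation p).
Proof.
move=> p01; have /andP[p0 p1] := p01.
apply/nonincreasing_seqP; elim => [|n IH]; first by have /andP[] := occupation01 1 p01.
rewrite /= ler_wpM2l//.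
have o1 := occupation01 n p01; have o2 := occupation01 n.+1 p01.
by apply: binomial_tail_homo; rewrite ?in_itv/=.
Qed.

Lemma occupation_cvg p : 0 <= p <= 1 -> exists L : R,
  [/\ 0 <= L <= 1, p * h L = L, occupation p @ \oo --> L &
      forall l, 0 <= l <= 1 -> l <= p * h l -> l <= L].
Proof.
move=> p01; have /andP[p0 p1] := p01.
have occ : cvgn (occupation p).
  apply: nonincreasing_is_cvgn; first exact: occupation_nonincreasing.
  by exists 0 => _ [n _ <-]; have /andP[] := occupation01 n p01.
exists (limn (occupation p)).
have LB l : 0 <= l <= 1 -> l <= p * h l -> l <= limn (occupation p).
  by move=> l01 lh; apply: limr_ge => //; apply: nearW => n; exact: le_occupation.
split=> //.
- apply/andP; split.
    by apply: LB; rewrite ?lexx ?ler01// mulr_ge0// binomial_tail_ge0// lexx ler01.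
  apply: limr_le => //; apply: nearW => n; by have /andP[] := occupation01 n p01.
- have c : (fun n => p * h (occupation p n)) @ \oo --> p * h (limn (occupation p)).
    apply: cvgMr; apply: continuous_cvg => //.
    exact: continuous_binomial_tail.
  rewrite -(cvg_lim _ c)//.
  move: occ => /cvg_ex[l ol]; rewrite (cvg_lim _ ol)//.
  by apply: cvg_lim => //; rewrite (cvg_shiftS (occupation p)).
Qed.

Let S := [set p : R | 0 <= p <= 1 /\
                   [set l : R | 0 <= l <= 1 /\ branching_map k j p l = l] = [set 0]].

Lemma subcriticalP p : 0 <= p <= 1 ->
  S p <-> forall l, 0 < l <= 1 -> p * h l != l.
Proof.
move=> p01; split=> [[_ H] l /andP[l0 l1]|H].
  apply/eqP => E; have : [set l : R | 0 <= l <= 1 /\ branching_map k j p l = l] l.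
    by rewrite /= branching_mapE// (ltW l0) l1.
  by rewrite H /= => l00; rewrite l00 ltxx in l0.
split=> //; apply/seteqP; split=> [l|_ ->] /=; rewrite branching_mapE//.
  case=> /andP[+ l1]; rewrite le_eqVlt => /predU1P[->//|l0] E.
  by have := H l; rewrite l0 l1 E eqxx => /(_ isT).
by rewrite lexx ler01 [binomial_tail _ _ _]binomial_tail_at0 mulr0.
Qed.

(** If [l <= p * h l], the limit of the iterates from [1] would be at least [l], hence a positive
    fixed point. *)
Lemma subcritical_lt p l : S p -> 0 < l <= 1 -> p * h l < l.
Proof.
move=> Sp /andP[l0 l1]; have [p01 _] := Sp.
rewrite ltNge; apply/negP => lh.
have [L [/andP[L0 L1] fL _ LB]] := occupation_cvg p01.
have lL : l <= L by apply: LB => //; rewrite (ltW l0).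
have /negP := (subcriticalP p01).1 Sp L (introT andP (conj (lt_le_trans l0 lL) L1)).
by rewrite fL eqxx.
Qed.

Lemma subcritical0 : S 0.
Proof.
apply/subcriticalP => [|l /andP[l0 _]]; first by rewrite lexx ler01.
by rewrite mul0r lt_eqF.
Qed.

Lemma has_sup_subcritical : has_sup S.
Proof. by split; [exists 0; exact: subcritical0|exists 1 => p [/andP[]]]. Qed.

Lemma ptilde_le1 : ptilde R k j <= 1.
Proof. by apply: ge_sup; [exists 0; exact: subcritical0|move=> p [/andP[]]]. Qed.

Lemma le_ptilde p : S p -> p <= ptilde R k j.
Proof. by move=> Sp; apply: ub_le_sup => //; exact: has_sup_subcritical.2. Qed.

(** Being below a supremum only yields some subcritical [p' > p]. A positive fixed point [L] of
    [g_p] would satisfy [L <= p' * h L], against [subcritical_lt]. *)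
Lemma occupation_subcritical p : 0 <= p <= 1 -> p < ptilde R k j ->
  occupation p @ \oo --> 0.
Proof.
move=> p01 /(sup_gt has_sup_subcritical.1)[p' Sp' pp'].
have [L [L01 fL oL _]] := occupation_cvg p01.
suff <- : L = 0 by [].
have /andP[] := L01; rewrite le_eqVlt => /predU1P[//|L0] L1.
have := subcritical_lt Sp'; move=> /(_ L); rewrite L0 L1 => /(_ isT).
rewrite -{2}fL ltNge => /negP[]; rewrite ler_wpM2r ?(ltW pp')//.
exact: binomial_tail_ge0.
Qed.

(** If the slope at [L] were at least [1], [h a / a] would be nondecreasing between [l'] and [L],
    where [l'] is a positive fixed point at a smaller supercritical density [p']. The end values
    [1 / p'] and [1 / p] would then contradict [p' < p]. *)
Lemma dbinomial_tail_supercritical p : ptilde R k j < p -> p < 1 -> 0 <= p ->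
  exists L : R, [/\ 0 < L <= 1, occupation p @ \oo --> L & p * dbinomial_tail k j L < 1].
Proof.
move=> pp p1 p0.
have p01 : 0 <= p <= 1 by rewrite p0 ltW.
(* Strictly above the threshold, hence not subcritical, yet strictly below [p]. *)
pose p' := (ptilde R k j + p) / 2.
have Pt0 := le_ptilde subcritical0.
have p'01 : 0 <= p' <= 1 by rewrite /p'; lra.
have : ~ S p' by move=> /le_ptilde; rewrite /p'; lra.
move=> /(subcriticalP p'01)/existsNP[l' /not_implyP[/andP[l'0 l'1] /negP]].
rewrite negbK => /eqP fl'.
have [L [/andP[L0 L1] fL oL LB]] := occupation_cvg p01.
have hl'0 : 0 <= h l' by apply: binomial_tail_ge0; rewrite (ltW l'0).
have p'p : p' < p by rewrite /p'; lra.
have l'L : l' <= L.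
  by apply: LB; rewrite ?(ltW l'0)// -{1}fl' ler_wpM2r// ltW.
have LL0 : 0 < L := lt_le_trans l'0 l'L.
exists L; split => //; first by rewrite LL0.
rewrite ltNge; apply/negP => dL.
have pp0 : 0 < p by rewrite (le_lt_trans Pt0).
have hL0 : 0 < h L.
  by rewrite -(pmulr_rgt0 _ pp0) fL.
have dL' : h L <= L * dbinomial_tail k j L.
  rewrite -(ler_pM2l pp0) fL mulrCA ler_peMr//.
(* By [binomial_tail_dratio] the inequality [dL'] at [L] propagates to all smaller [a]; it says that
   [f], that is [h a / a], has a nonnegative derivative. *)
have da a : l' <= a -> a <= L -> h a <= a * dbinomial_tail k j a.
  move=> la aL; have a0 : 0 < a := lt_le_trans l'0 la.
  have := @binomial_tail_dratio R k j a L; rewrite j_gt0 jk (ltW a0) aL L1.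
  move=> /(_ isT isT isT) H.
  have ha0 : 0 <= h a.
    by apply: binomial_tail_ge0; rewrite (ltW a0) (le_trans aL).
  rewrite -(ler_pM2l hL0) (le_trans _ H)// mulrC ler_wpM2l//.
pose f a := a^-1 * h a; pose df a := a^-1 * dbinomial_tail k j a - a ^- 2 * h a.
have fD (x : R) : 0 < x -> is_derive x 1 f (df x).
  move=> x0; have := is_derive_binomial_tail k j x; rewrite -/h => ?.
  have -> : f = (fun a => a^-1) * h by [].
  have x0' : id x != 0 by rewrite gt_eqF.
  pose i1 := @is_deriveV R id x 1 1 x0' (is_derive_id _ _).
  have -> : df x = x^-1 *: dbinomial_tail k j x + h x *: (- (x ^- 2) *: 1).
    by rewrite /df /GRing.scale/=; ring.
  exact: is_deriveM.
have [||c] := @MVT_segment R f df l' L l'L.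
- by move=> x; rewrite in_itv/= => /andP[/(lt_trans l'0) + _]; exact: fD.
- apply: derivable_within_continuous => x; rewrite in_itv/= => /andP[lx _].
  by have [] := fD x (lt_le_trans l'0 lx).
rewrite in_itv/= => /andP[lc cL].
have c0 : 0 < c := lt_le_trans l'0 lc.
have dc0 : 0 <= df c.
  have -> : df c = c ^- 2 * (c * dbinomial_tail k j c - h c).
    by rewrite /df; field; rewrite gt_eqF.
  by rewrite mulr_ge0 ?subr_ge0 ?da// invr_ge0 sqr_ge0.
move=> E; have : 0 <= f L - f l' by rewrite E mulr_ge0// subr_ge0.
rewrite subr_ge0 /f.
have -> : L^-1 * h L = p^-1.
  by rewrite -{1}fL invfM -mulrA mulVf ?mulr1// gt_eqF.
have p'0 : 0 < p' by rewrite /p'; lra.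
have hl' : h l' != 0.
  by apply: contraTneq l'0 => h0; rewrite -fl' h0 mulr0 ltxx.
have -> : l'^-1 * h l' = p'^-1.
  by rewrite -{1}fl' invfM -mulrA mulVf ?mulr1.
by rewrite lef_pV2// leNgt p'p.
Qed.

(** A union bound: fewer than [m <= n] failures among [n] trials leave at least one success. *)
Lemma binomial_tail_leMn m l : 0 <= l <= 1 -> forall n, (m <= n)%N ->
  binomial_tail n m l <= n%:R * l.
Proof.
move=> /[dup] l01 /andP[l0 l1] n; elim: n m => [|n IH] m mn.
  by move: mn; rewrite leqn0 => /eqP ->; rewrite binomial_tail0 mul0r.
have -> : n.+1%:R * l = n%:R * l + l by rewrite -natr1; ring.
rewrite binomial_tailS addrC lerD//.
  rewrite (le_trans (y := 1 * binomial_tail n m.-1 l))//.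
    by rewrite ler_wpM2r ?binomial_tail_ge0// gerBl.
  by rewrite mul1r IH//; case: m mn.
by rewrite ler_piMr// binomial_tail_le1.
Qed.

Lemma ptilde_gt0 : 0 < ptilde R k j.
Proof.
have k0 : 0 < k%:R :> R by rewrite ltr0n (leq_trans j_gt0).
have k1 : 1 <= k%:R :> R by rewrite ler1n (leq_trans j_gt0).
(* At [p = 1 / (2 k)] the union bound gives [p * h l <= l / 2], which excludes positive fixed
   points. *)
have P0 : 0 < (2 * k%:R)^-1 :> R by rewrite invr_gt0 mulr_gt0.
apply: (lt_le_trans P0); apply: le_ptilde; apply/subcriticalP.
  by rewrite (ltW P0) invf_le1 ?mulr_gt0//; lra.
move=> l /andP[l0 l1]; rewrite lt_eqF//.
have h1 : h l <= k%:R * l by apply: binomial_tail_leMn => //; rewrite (ltW l0).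
rewrite -(ltr_pM2l (_ : 0 < 2 * k%:R)) ?mulr_gt0// mulrA mulfV ?gt_eqF ?mulr_gt0//.
rewrite mul1r (le_lt_trans h1)// -mulrA ltr_pMl ?mulr_gt0//; lra.
Qed.

(** For [j = 1], [g_p(l) = p * l ^ k] stays below [l] for all [p < 1]. For [j >= 2] the complement
    of the tail event requires two failures, so [1 - h l] is quadratic in [1 - l] and [h l > l] near
    [1]; subcritical densities are then at most [l / h l < 1]. *)
Lemma ptilde_lt1 : (ptilde R k j < 1) = (1 < j)%N.
Proof.
apply/idP/idP => [|j1].
  rewrite ltnNge; apply: contraTN => j1; rewrite -leNgt.
  have {j1} jE : j = 1%N by apply/eqP; rewrite eqn_leq j1.
  rewrite leNgt; apply/negP => p1.
  pose p := (ptilde R k j + 1) / 2.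
  have pt0 := ptilde_gt0.
  suff : S p by move=> /le_ptilde; rewrite /p; lra.
  apply/subcriticalP => [|l /andP[l0 l1]]; first by rewrite /p; lra.
  rewrite lt_eqF// /h jE /binomial_tail big_ord1 bin0 mul1r subn0 expr0 mulr1.
  have : l ^+ k <= l by rewrite -[leRHS]expr1 ler_wiXn2l ?(ltW l0)// (leq_trans j_gt0).
  move=> lk; rewrite (le_lt_trans (y := p * l))//.
    by rewrite ler_wpM2l// /p; lra.
  by rewrite gtr_pMl// /p; lra.
have H1 n m l : 0 <= l <= 1 -> (0 < m)%N -> 1 - binomial_tail n m l <= n%:R * (1 - l).
  move=> /[dup] l01 /andP[l0 l1]; elim: n m => [|n IH] m m0.
    by rewrite binomial_tail0 m0 mul0r subrr.
  rewrite binomial_tailS -natr1; have := IH _ m0.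
  have := binomial_tail_ge0 n m.-1 l01; have := binomial_tail_le1 n m l01; nra.
have H2 n m l : 0 <= l <= 1 -> (1 < m)%N -> 1 - binomial_tail n m l <= (n%:R * (1 - l)) ^+ 2.
  move=> /[dup] l01 /andP[l0 l1]; elim: n m => [|n IH] m m1.
    by rewrite binomial_tail0 (ltnW m1) mul0r subrr expr0n.
  rewrite binomial_tailS -natr1; have := IH _ m1.
  have := H1 n m.-1 l l01; rewrite -ltnS prednK ?(ltnW m1)// => /(_ m1).
  have := binomial_tail_le1 n m l01.
  set a := binomial_tail n m l; set b := binomial_tail n m.-1 l.
  have : 0 <= n%:R :> R by [].
  set N := n%:R; move=> N0 a1 hb ha.
  have : l * (1 - a) <= 1 * (1 - a) by rewrite ler_wpM2r// subr_ge0.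
  have : (1 - l) * (1 - b) <= (1 - l) * (N * (1 - l)) by rewrite ler_wpM2l// subr_ge0.
  have : 0 <= N * (1 - l) ^+ 2 by rewrite mulr_ge0// sqr_ge0.
  have : 0 <= (1 - l) ^+ 2 by rewrite sqr_ge0.
  by nra.
have k1 : 1 <= k%:R :> R by rewrite ler1n (leq_trans j_gt0).
(* Chosen so that the quadratic bound [(k * e) ^ 2] equals [e / 2]; at [l = 1 - e] it gives
   [h l >= 1 - e / 2 > l]. *)
pose e : R := (2 * k%:R ^+ 2)^-1.
have k2 : 1 <= k%:R ^+ 2 :> R by rewrite exprn_ege1.
have e0 : 0 < e by rewrite invr_gt0; lra.
have e1 : e <= 2^-1 by rewrite lef_pV2 ?posrE; lra.
have eE : k%:R ^+ 2 * e = 2^-1 by rewrite /e invfM mulrCA mulfV ?mulr1// gt_eqF//; lra.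
pose l := 1 - e.
have l01 : 0 <= l <= 1 by rewrite /l; lra.
have l0 : 0 < l by rewrite /l; lra.
have El : 1 - l = e by rewrite /l; ring.
have := H2 k j l l01 j1; rewrite -/h El.
have -> : (k%:R * e) ^+ 2 = e * (k%:R ^+ 2 * e) by ring.
rewrite eE => hl.
have lh : l < h l by rewrite /l; lra.
have h0 : 0 < h l := lt_trans l0 lh.
apply: (@le_lt_trans _ _ (l / h l)); last by rewrite ltr_pdivrMr// mul1r.
apply: ge_sup; first by exists 0; exact: subcritical0.
move=> p Sp; rewrite ler_pdivlMr//; apply/ltW/subcritical_lt => //.
by rewrite l0; case/andP: l01.
Qed.

End BranchingDynamics.

(** * The product measure *)

Section LocalFunctions.
Context (R : realType) (V : countType).
Implicit Types (w : config V) (x y : V) (S : seq V).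

(** Unlike [local_function], keeps the support explicit, as independence requires, and allows any
    codomain. *)
Definition depends_on T S (f : config V -> T) :=
  forall w w', {in S, w =1 w'} -> f w = f w'.

Lemma set_spin_eq w x b : set_spin w x b x = b.
Proof. by rewrite /set_spin eqxx. Qed.

Lemma set_spin_neq w x b y : y != x -> set_spin w x b y = w y.
Proof. by rewrite /set_spin => /negbTE ->. Qed.

Lemma set_spin_id w x : set_spin w x (w x) = w.
Proof. by apply/funext => y; rewrite /set_spin; case: eqP => [->|]. Qed.

Lemma set_spinK w x b c : set_spin (set_spin w x b) x c = set_spin w x c.
Proof. by apply/funext => y; rewrite /set_spin; case: eqP. Qed.

Lemma set_spinC w x b y c : x != y ->
  set_spin (set_spin w x b) y c = set_spin (set_spin w y c) x b.
Proof.
move=> xy; apply/funext => z; rewrite /set_spin.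
by case: eqVneq => // ->; rewrite eq_sym (negbTE xy).
Qed.

Lemma depends_on_set_spin T S (f : config V -> T) x b w :
  depends_on S f -> x \notin S -> f (set_spin w x b) = f w.
Proof.
move=> fS xS; apply: fS => y yS; rewrite set_spin_neq//.
by apply: contraNneq xS => <-.
Qed.

Lemma depends_on_set_spinP T S (f : config V -> T) x b :
  depends_on S f -> depends_on S (fun w => f (set_spin w x b)).
Proof. by move=> fS w w' ww'; apply: fS => y yS; rewrite /set_spin ww'. Qed.

Lemma depends_on_set_spin_rem T S (f : config V -> T) x b :
  depends_on (x :: S) f -> depends_on S (fun w => f (set_spin w x b)).
Proof.
move=> fS w w' ww'; apply: fS => y; rewrite inE /set_spin.
by case: eqVneq => //= _; exact: ww'.
Qed.

Lemma depends_on_comp T T' S (F : T -> T') (f : config V -> T) :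
  depends_on S f -> depends_on S (fun w => F (f w)).
Proof. by move=> fS w w' ww'; rewrite (fS _ _ ww'). Qed.

Lemma depends_on_comp2 T T' T'' S S' (F : T -> T' -> T'') (f : config V -> T)
    (g : config V -> T') :
  depends_on S f -> depends_on S' g -> depends_on (S ++ S') (fun w => F (f w) (g w)).
Proof.
move=> fS gS w w' ww'; rewrite (fS w w') ?(gS w w')// => x xS; apply: ww';
  by rewrite mem_cat xS ?orbT.
Qed.

Lemma depends_on_coord x : depends_on [:: x] (fun w => w x).
Proof. by move=> w w' ww'; apply: ww'; rewrite inE. Qed.

Lemma depends_on_nil T (f : config V -> T) : depends_on [::] f -> forall w w', f w = f w'.
Proof. by move=> f0 w w'; exact: f0. Qed.

Lemma measurable_occupied x : measurable [set w : config V | w x].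
Proof. by apply: sub_gen_smallest; exists x. Qed.

Lemma measurable_coord x : measurable_fun [set: config V] (fun w : config V => w x).
Proof. by apply: measurable_fun_bool true _ => //; rewrite setTI; exact: measurable_occupied. Qed.

Lemma measurable_set_spin x b :
  measurable_fun [set: config V] (fun w => set_spin w x b : config V).
Proof.
apply: (@measurability _ _ _ (config V) setT _ (@coordinate_events V)) => //.
move=> _ [_ [y _ <-] <-]; rewrite setTI.
have [->|yx] := eqVneq y x.
  case: b; [rewrite (_ : _ @^-1` _ = setT)//|rewrite (_ : _ @^-1` _ = set0)//].
    by apply/seteqP; split => w //= _; rewrite set_spin_eq.
  by apply/seteqP; split => w //=; rewrite set_spin_eq.
rewrite (_ : _ @^-1` _ = [set w : config V | w y]); first exact: measurable_occupied.
by apply/seteqP; split => w /=; rewrite set_spin_neq.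
Qed.

(** Induction on the support: [f] is a case split on the spin at [x] between two functions supported
    on the rest. *)
Lemma depends_on_measurable d (T : measurableType d) S (f : config V -> T) :
  depends_on S f -> measurable_fun setT f.
Proof.
elim: S f => [|x S IH] f fS.
  by rewrite (_ : f = cst (f (fun=> true)))//; apply/funext => w; exact: depends_on_nil fS _ _.
rewrite (_ : f = fun w => if w x then f (set_spin w x true) else f (set_spin w x false)).
  apply: measurable_fun_ifT; first exact: measurable_coord.
  - by apply: IH; exact: depends_on_set_spin_rem.
  - by apply: IH; exact: depends_on_set_spin_rem.
by apply/funext => w; case: ifPn => [wx|/negbTE wx]; rewrite -{1}[w](set_spin_id w x) wx.
Qed.

Lemma depends_on_bounded S (f : config V -> R) :
  depends_on S f -> exists M, forall w, `|f w| <= M.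
Proof.
elim: S f => [|x S IH] f fS.
  by exists `|f (fun=> true)| => w; rewrite (depends_on_nil fS w (fun=> true)).
have [M1 H1] := IH _ (@depends_on_set_spin_rem _ S f x true fS).
have [M2 H2] := IH _ (@depends_on_set_spin_rem _ S f x false fS).
exists (Num.max M1 M2) => w; rewrite le_max -(set_spin_id w x).
by case: (w x); rewrite ?H1 ?H2 ?orbT.
Qed.

End LocalFunctions.

(** * Invariance of the product measure under resampling one spin *)

Section BernoulliProduct.
Context (R : realType) (V : countType) (p : R).
Hypothesis p01 : 0 <= p <= 1.
Let mu := bernoulli_product V p.
Implicit Types (w : config V) (x y : V) (S : seq V).

Let p0 : 0 <= p. Proof. by case/andP: p01. Qed.
Let q0 : 0 <= 1 - p. Proof. by rewrite subr_ge0; case/andP: p01. Qed.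

(** A generating pi-system with a single shape of event, on which two measures are easily
    compared. *)
Definition all_occupied S : set (config V) := [set w : config V | all (w : pred V) S].

Let all_occupiedE S : all_occupied S = [set w : config V | {in undup S, w =1 fun=> true}].
Proof.
apply/seteqP; split => w /= => [/allP wS x|wS]; first by rewrite mem_undup => /wS ->.
by apply/allP => x; rewrite -mem_undup => /wS ->.
Qed.

Let mu_all_occupied S : mu (all_occupied S) = (p ^+ size (undup S))%:E.
Proof.
rewrite all_occupiedE bernoulli_productP// ?undup_uniq//; congr EFin.
by rewrite big_const_seq count_predT iter_mulr_1.
Qed.

Lemma measurable_all_occupied S : measurable (all_occupied S).
Proof.
rewrite (_ : all_occupied S = (fun w : config V => all (w : pred V) S) @^-1` [set true]).
  rewrite -[X in measurable X]setTI.
  apply: (@depends_on_measurable _ _ _ S (fun w : config V => all (w : pred V) S)) => //.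
  by move=> w w' ww'; apply: eq_in_all.
by apply/seteqP; split => w.
Qed.

Let s x b : config V -> config V := fun w => set_spin w x b.
HB.instance Definition _ x b :=
  isMeasurableFun.Build _ _ _ _ (s x b) (@measurable_set_spin V x b).

(** The law of a [mu]-distributed configuration after its spin at [x] has been redrawn. *)
Let nu x : {measure set (config V) -> \bar R} :=
  measure_add (mscale (NngNum p0) (distribution mu (s x true)))
    (mscale (NngNum q0) (distribution mu (s x false))).

Let preimage_all_occupied_true x S :
  s x true @^-1` all_occupied S = all_occupied [seq y <- S | y != x].
Proof.
apply/seteqP; split => w /= /allP wS; apply/allP => y.
  by rewrite mem_filter => /andP[yx /wS]; rewrite /s set_spin_neq.
have [->|yx yS] := eqVneq y x; first by rewrite /s set_spin_eq.
by rewrite /s set_spin_neq// wS// mem_filter yx.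
Qed.

Let preimage_all_occupied_false x S : s x false @^-1` all_occupied S =
  if x \in S then set0 else all_occupied S.
Proof.
case: ifPn => xS; apply/seteqP; split => w //= /allP wS.
- by have := wS _ xS; rewrite /s set_spin_eq.
- apply/allP => y yS; have := wS _ yS; rewrite /s set_spin_neq//.
  by apply: contraNneq xS => <-.
- apply/allP => y yS; rewrite /s set_spin_neq ?wS//.
  by apply: contraNneq xS => <-.
Qed.

Let nuE x A : nu x A =
  (p%:E * mu (s x true @^-1` A) + (1 - p)%:E * mu (s x false @^-1` A))%E.
Proof. exact: measure_addE. Qed.

(** [mu] and [nu x] agree on the pi-system [all_occupied]. This identity stands in for Fubini:
    independence and integration by parts both derive from it. *)
Lemma bernoulli_product_set_spin x A : measurable A ->
  mu A = (p%:E * mu (s x true @^-1` A) + (1 - p)%:E * mu (s x false @^-1` A))%E.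
Proof.
move=> mA; rewrite -nuE.
pose G := range all_occupied.
apply: (measure_unique G (fun=> setT)) => //.
- apply/seteqP; split; apply: smallest_sub; try exact: smallest_sigma_algebra.
  + move=> _ [y _ <-]; apply: sub_gen_smallest; exists [:: y] => //.
    by apply/seteqP; split => w /=; rewrite /all_occupied/= andbT.
  + by move=> _ [S _ <-]; exact: measurable_all_occupied.
- move=> _ _ [S _ <-] [S' _ <-]; exists (S ++ S') => //.
  by apply/seteqP; split => w /=; rewrite /all_occupied/= all_cat => /andP.
- by move=> _; exists [::] => //; apply/seteqP; split.
- by rewrite bigcup_const//; exists 0%N.
- move=> _ [S _ <-]; rewrite [RHS]nuE preimage_all_occupied_true.
  rewrite preimage_all_occupied_false mu_all_occupied [LHS]mu_all_occupied.
  rewrite -filter_undup size_filter.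
  (* If [x] lies in [S], an empty spin at [x] is impossible and an occupied one saves a factor [p];
     otherwise both terms see the same event. *)
  case: ifPn => xS.
    rewrite measure0 mule0 adde0 -EFinM -exprS; congr EFin; congr (_ ^+ _).
    rewrite -(count_predC (pred1 x)) count_uniq_mem ?undup_uniq//.
    by rewrite mem_undup xS.
  have -> : count (fun y => y != x) (undup S) = size (undup S).
    apply/eqP; rewrite -all_count; apply/allP => y.
    by rewrite mem_undup => yS /=; apply: contraNneq xS => <-.
  rewrite [in RHS]mu_all_occupied -!EFinM -EFinD; congr EFin; ring.
- by move=> _; rewrite (le_lt_trans (probability_le1 _ _)) ?ltry.
Qed.

Lemma integral_set_spin x (f : config V -> R) :
  measurable_fun [set: config V] f -> (forall w, 0 <= f w) ->
  (\int[mu]_w (f w)%:E = p%:E * \int[mu]_w (f (set_spin w x true))%:E +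
                    (1 - p)%:E * \int[mu]_w (f (set_spin w x false))%:E)%E.
Proof.
move=> mf f0.
transitivity (\int[nu x]_w (f w)%:E)%E.
  apply: eq_measure_integral => A mA _.
  exact: (etrans (bernoulli_product_set_spin x mA) (esym (nuE x A))).
have mf' := (measurable_EFinP _ _).2 mf.
rewrite ge0_integral_measure_add//; last by move=> w _; rewrite lee_fin.
rewrite !ge0_integral_mscale//=; try by move=> w _; rewrite lee_fin.
by rewrite !ge0_integral_distribution// => w; rewrite lee_fin.
Qed.

End BernoulliProduct.

(** * Expectation of local functions, and independence *)

Section LocalExpectation.
Context (R : realType) (V : countType) (p : R).
Hypothesis p01 : 0 <= p <= 1.
Let mu := bernoulli_product V p.
Implicit Types (f g : config V -> R) (S : seq V).

Definition expect f : R := \int[mu]_w f w.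

Lemma local_cst c : local_function (fun _ : config V => c : R).
Proof. by exists [::]. Qed.

Lemma localD f g : local_function f -> local_function g ->
  local_function (fun w => f w + g w).
Proof.
move=> [S fS] [S' gS]; exists (S ++ S').
exact: (@depends_on_comp2 _ _ _ _ _ _ (fun a b : R => a + b)).
Qed.

Lemma localM f g : local_function f -> local_function g ->
  local_function (fun w => f w * g w).
Proof.
move=> [S fS] [S' gS]; exists (S ++ S').
exact: (@depends_on_comp2 _ _ _ _ _ _ (fun a b : R => a * b)).
Qed.

Lemma local_comp (F : R -> R) f : local_function f -> local_function (fun w => F (f w)).
Proof. by move=> [S fS]; exists S; exact: depends_on_comp. Qed.

Lemma localN f : local_function f -> local_function (fun w => - f w).
Proof. exact: local_comp. Qed.

Lemma localB f g : local_function f -> local_function g ->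
  local_function (fun w => f w - g w).
Proof. by move=> lf lg; apply: localD => //; exact: localN. Qed.

Lemma local_bool S (b : config V -> bool) : depends_on S b ->
  local_function (fun w => (b w)%:R : R).
Proof. by move=> bS; exists S; exact: (@depends_on_comp _ _ _ _ (fun b : bool => b%:R)). Qed.

Lemma local_sum (I : eqType) (r : seq I) (P : pred I) (F : I -> config V -> R) :
  (forall i, i \in r -> local_function (F i)) ->
  local_function (fun w => \sum_(i <- r | P i) F i w).
Proof.
elim: r => [|i r IH] H.
  by rewrite (_ : (fun _ => _) = fun=> 0); [exact: local_cst|apply/funext => w; rewrite big_nil].
have lr : local_function (fun w => \sum_(i <- r | P i) F i w).
  by apply: IH => i' ir; apply: H; rewrite inE ir orbT.
have li : local_function (F i) by apply: H; rewrite mem_head.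
case: (boolP (P i)) => Pi.
  rewrite (_ : (fun _ => _) = fun w => F i w + \sum_(i <- r | P i) F i w).
    exact: localD.
  by apply/funext => w; rewrite big_cons Pi.
rewrite (_ : (fun _ => _) = fun w => \sum_(i <- r | P i) F i w)//.
by apply/funext => w; rewrite big_cons (negbTE Pi).
Qed.

Lemma local_set_spin x b f : local_function f -> local_function (fun w => f (set_spin w x b)).
Proof. by move=> [S fS]; exists S; exact: depends_on_set_spinP. Qed.

Lemma local_site_average x f : local_function f -> local_function (site_average p x f).
Proof.
by move=> lf; apply: localD; apply: localM; do ?exact: local_cst; exact: local_set_spin.
Qed.

Lemma local_measurable f : local_function f -> measurable_fun [set: config V] f.
Proof. by move=> [S]; exact: depends_on_measurable. Qed.

Lemma local_integrable f : local_function f -> mu.-integrable [set: config V] (EFin \o f).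
Proof.
move=> /[dup] lf [S fS]; have [M fM] := depends_on_bounded fS.
apply: (@le_integrable _ _ _ mu setT _ _ (EFin \o cst M)) => //.
- apply/measurable_EFinP. exact: local_measurable.
- by move=> w _ /=; rewrite lee_fin (le_trans (fM w))// ler_norm.
- exact: finite_measure_integrable_cst.
Qed.

Lemma expectE f : local_function f -> ((expect f)%:E = \int[mu]_w (f w)%:E)%E.
Proof. by move=> lf; rewrite fineK//; apply: integrable_fin_num => //; exact: local_integrable. Qed.

Lemma expect_cst c : expect (fun=> c) = c.
Proof.
rewrite /expect Rintegral_cst// -[RHS]mulr1; congr (_ * _).
by rewrite [X in fine X](_ : _ = 1%E)//; exact: probability_setT.
Qed.

Lemma expectD f g : local_function f -> local_function g ->
  expect (fun w => f w + g w) = expect f + expect g.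
Proof. by move=> lf lg; rewrite /expect RintegralD//; exact: local_integrable. Qed.

Lemma expectB f g : local_function f -> local_function g ->
  expect (fun w => f w - g w) = expect f - expect g.
Proof. by move=> lf lg; rewrite /expect RintegralB//; exact: local_integrable. Qed.

Lemma expectZ c f : local_function f -> expect (fun w => c * f w) = c * expect f.
Proof. by move=> lf; rewrite /expect RintegralZl//; exact: local_integrable. Qed.

Lemma expect_le f g : local_function f -> local_function g ->
  (forall w, f w <= g w) -> expect f <= expect g.
Proof. by move=> lf lg fg; apply: le_Rintegral => //; exact: local_integrable. Qed.

Lemma expect_ge0 f : (forall w, 0 <= f w) -> 0 <= expect f.
Proof. by move=> f0; exact: Rintegral_ge0. Qed.

Lemma expect_sum (I : eqType) (r : seq I) (P : pred I) (F : I -> config V -> R) :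
  (forall i, i \in r -> local_function (F i)) ->
  expect (fun w => \sum_(i <- r | P i) F i w) = \sum_(i <- r | P i) expect (F i).
Proof.
elim: r => [|i r IH] H.
  by rewrite big_nil -[RHS]expect_cst; congr expect; apply/funext => w; rewrite big_nil.
have lr i' : i' \in r -> local_function (F i').
  by move=> ir; apply: H; rewrite inE ir orbT.
have li : local_function (F i) by apply: H; rewrite mem_head.
rewrite big_cons; case: (boolP (P i)) => Pi; rewrite -IH//; last first.
  by congr expect; apply/funext => w; rewrite big_cons (negbTE Pi).
rewrite -expectD//; last exact: local_sum.
by congr expect; apply/funext => w; rewrite big_cons Pi.
Qed.

Lemma expect_set_spin x f : local_function f ->
  expect f = p * expect (fun w => f (set_spin w x true)) +
             (1 - p) * expect (fun w => f (set_spin w x false)).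
Proof.
move=> /[dup] lf [S fS]; have [M fM] := depends_on_bounded fS.
(* [integral_set_spin] is about nonnegative functions, so [f] is first shifted by a bound [M]. *)
have lfM : local_function (fun w => f w + M) by apply: localD => //; exact: local_cst.
have fM0 w : 0 <= f w + M.
  by rewrite -lerBlDr sub0r (le_trans _ (lerNnormlW (fM w)))//.
have := integral_set_spin p01 x (local_measurable lfM) fM0.
have ED g : local_function g -> expect (fun w => g w + M) = expect g + M.
  by move=> lg; rewrite expectD ?expect_cst//; exact: local_cst.
have l1 b := local_set_spin x b lfM; have l2 b := local_set_spin x b lf.
rewrite -(expectE lfM) -(expectE (l1 true)) -(expectE (l1 false)).
by rewrite !ED// => -[]; lra.
Qed.

(** Independence, by conditioning on the spins in the support of [f] one at a time; [g] is
    insensitive to each of them. *)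
Lemma expectM S S' f g : depends_on S f -> depends_on S' g ->
  {in S, forall x, x \notin S'} ->
  expect (fun w => f w * g w) = expect f * expect g.
Proof.
elim: S f => [|x S IH] f fS gS' SS'.
  have fE w : f w = f (fun=> true) by exact: depends_on_nil fS _ _.
  rewrite (_ : f = fun=> f (fun=> true)); last by apply/funext => w; exact: fE.
  by rewrite expect_cst expectZ//; exists S'.
have lf : local_function f by exists (x :: S).
have lg : local_function g by exists S'.
rewrite (expect_set_spin x)//; last exact: localM.
have gE b : (fun w => f (set_spin w x b) * g (set_spin w x b)) =
    (fun w => f (set_spin w x b) * g w).
  by apply/funext => w; rewrite (depends_on_set_spin _ _ gS')// SS'// mem_head.
rewrite !gE !IH//; try exact: depends_on_set_spin_rem; try by
  move=> y yS; apply: SS'; rewrite inE yS orbT.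
by rewrite [in RHS](expect_set_spin x)//; ring.
Qed.

End LocalExpectation.

(** * Blocked vertices of a rooted tree *)

(* A rooting of the graph with constraint neighborhoods [N]: besides its kids,
   a vertex may only have its parent as a neighbor, and every vertex but the
   root has exactly [k] kids. *)
Record rooting (V : countType) (k : nat) (N : V -> seq V) := Rooting {
  tree_root : V;
  parent : V -> V;
  depth : V -> nat;
  kids : V -> seq V;
  depth_tree_root : depth tree_root = 0%N;
  depth_kids : forall x y, y \in kids x -> depth y = (depth x).+1;
  parent_kids : forall x y, y \in kids x -> parent y = x;
  kids_uniq : forall x, uniq (kids x);
  size_kids : forall x, (0 < depth x)%N -> size (kids x) = k;
  size_kids_ge : forall x, (k <= size (kids x))%N;
  nbrs_uniq : forall x, uniq (N x);
  kids_nbrs : forall x, {subset kids x <= N x};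
  nbrs_kids : forall x y, y \in N x -> y \in kids x \/ x \in kids y }.

Section Tree.
Context (V : countType) (k j : nat) (N : V -> seq V) (T : rooting k N).
Implicit Types (w : config V) (x y z : V).

Let kids := kids T.
Let depth := depth T.
Let parent := parent T.

Fixpoint blocked n y w : bool :=
  if n is n'.+1 then w y && (count (fun z => ~~ blocked n' z w) (kids y) < j)%N
  else true.

Fixpoint zone n y : seq V :=
  if n is n'.+1 then y :: flatten [seq zone n' z | z <- kids y] else [::].

(** Generation [n] below [y]. It is the last of the [n.+1] generations in [zone n.+1 y], the sites
    that [blocked n.+1 y] reads, and the one whose kids are taken as blocked. *)
Fixpoint level n y : seq V :=
  if n is n'.+1 then flatten [seq level n' z | z <- kids y] else [:: y].

Lemma zone_cons n y z : z \in kids y -> {subset zone n z <= zone n.+1 y}.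
Proof.
move=> zy x xz; rewrite /= inE; apply/orP; right.
by apply/flatten_mapP; exists z.
Qed.

Lemma blocked_depends n y : depends_on (zone n y) (blocked n y).
Proof.
elim: n y => [|n IH] y w w' ww' //=.
rewrite ww' ?mem_head//; congr (_ && (_ < j)%N).
by apply: eq_in_count => z zy; congr (~~ _); apply: IH => x /(zone_cons zy); exact: ww'.
Qed.

(** Climbing from [x] by the difference of depths recovers [y]; hence zones of distinct vertices of
    equal depth are disjoint. *)
Lemma zone_parent n y x : x \in zone n y ->
  (depth y <= depth x)%N /\ iter (depth x - depth y) parent x = y.
Proof.
elim: n y => [|n IH] y //=; rewrite inE => /predU1P[->|]; first by rewrite subnn.
move=> /flatten_mapP[z zy /IH[]].
have -> : depth z = (depth y).+1 := depth_kids zy.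
move=> yx E; split; first exact: ltnW.
by rewrite -(subnSK yx) iterS E; exact: parent_kids zy.
Qed.

Lemma zone_disjoint n m y z x : depth y = depth z ->
  x \in zone n y -> x \in zone m z -> y = z.
Proof. by move=> yz /zone_parent[_ <-] /zone_parent[_ <-]; rewrite yz. Qed.

Lemma zone_kid n y z : z \in kids y -> y \notin zone n z.
Proof.
move=> zy; apply/negP => /zone_parent[+ _].
by rewrite [depth z](depth_kids zy) ltnn.
Qed.

Lemma level_zone n y : {subset level n y <= zone n.+1 y}.
Proof.
elim: n y => [|n IH] y x; first by rewrite !inE => ->.
move=> /= /flatten_mapP[z zy /IH xz]; rewrite inE; apply/orP; right.
by apply/flatten_mapP; exists z.
Qed.

Lemma leq_blocked n y w w' : (forall x, w x -> w' x) -> blocked n y w -> blocked n y w'.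
Proof.
move=> ww'; elim: n y => [|n IH] y //= /andP[wy cj].
rewrite ww'//= (leq_ltn_trans _ cj)//; apply: sub_count => z /=.
by apply: contra; exact: IH.
Qed.

Lemma blockedS n y w : blocked n.+1 y w -> blocked n y w.
Proof.
elim: n y => [//|n IH] y; rewrite [blocked n.+2 y w]/= => /andP[wy cj] /=.
rewrite wy/= (leq_ltn_trans _ cj)//; apply: sub_count => z /=.
by apply: contra; exact: IH.
Qed.

Lemma blockedW n m y w : (m <= n)%N -> blocked n y w -> blocked m y w.
Proof. by move=> /subnK <-; elim: (n - m)%N => // d IH /blockedS. Qed.

(* The kids are treated before [y] itself, so that every flip is legal when it
   is performed. *)
Fixpoint clean n y w : config V :=
  if n is n'.+1 then
    let w' := foldr (clean n') w (kids y) in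
    if (j <= count (fun z => ~~ w' z) (kids y))%N then set_spin w' y false else w'
  else w.

Let foldr_clean_aux n s w : (forall y w x, clean n y w x -> w x) ->
  forall x, foldr (clean n) w s x -> w x.
Proof. by move=> H; elim: s => //= y s IH x /H /IH. Qed.

Lemma leq_clean n y w x : clean n y w x -> w x.
Proof.
elim: n y w x => [|n IH] y w x //=.
case: ifP => _; last exact: foldr_clean_aux.
by rewrite /set_spin; case: eqP => // _; exact: foldr_clean_aux.
Qed.

Lemma leq_foldr_clean n s w x : foldr (clean n) w s x -> w x.
Proof. by apply: foldr_clean_aux => y u z; exact: leq_clean. Qed.

(** Vertices cleaned before [z] only lose particles, which cannot block [z]; those cleaned after it
    cannot refill it. *)
Let clean_foldr n s w z : z \in s -> (forall w, ~~ blocked n z w -> clean n z w z = false) ->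
  ~~ blocked n z w -> foldr (clean n) w s z = false.
Proof.
move=> + H zw; elim: s => //= y s IH; rewrite inE; have [<-|yz] := eqVneq z y => /=.
  move=> _; apply: H; apply: contra zw; apply: leq_blocked => x.
  by exact: leq_foldr_clean.
by move=> /IH zs; apply: contraFF zs; exact: leq_clean.
Qed.

(** By induction the unblocked kids are emptied first, so an occupied [y] has [j] empty kids when
    its turn comes; an empty [y] stays empty. *)
Lemma clean_unblocked n y w : ~~ blocked n y w -> clean n y w y = false.
Proof.
elim: n y w => [//|n IH] y w; rewrite [blocked _ _ _]/= negb_and -leqNgt => H.
rewrite /=; case: ifPn => [_|]; first by rewrite set_spin_eq.
case: (boolP (w y)) H => [_ /= cj|wy _ _]; last first.
  by apply: contraNF wy; exact: leq_foldr_clean.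
move=> h; case/negP: h; apply: leq_trans cj _.
rewrite -!size_filter; apply: uniq_leq_size; first by rewrite filter_uniq// kids_uniq.
move=> z; rewrite !mem_filter => /andP[zw zy]; rewrite zy andbT.
by rewrite (@clean_foldr n (kids y) w z)// => *; exact: IH.
Qed.

Lemma foldr_clean_unblocked n s w z : z \in s -> ~~ blocked n z w ->
  foldr (clean n) w s z = false.
Proof. by move=> zs zw; apply: clean_foldr => // *; exact: clean_unblocked. Qed.

Let foldr_clean_set_spin n s w x b :
  (forall y w, (depth x < depth y)%N ->
     clean n y (set_spin w x b) = set_spin (clean n y w) x b) ->
  {in s, forall y, (depth x < depth y)%N} ->
  foldr (clean n) (set_spin w x b) s = set_spin (foldr (clean n) w s) x b.
Proof.
move=> H; elim: s => //= y s IH sx; rewrite IH; last first.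
  by move=> z zs; apply: sx; rewrite inE zs orbT.
by apply: H; apply: sx; rewrite mem_head.
Qed.

(** Cleaning [y] only reads and changes sites at the depth of [y] or below it. This lets the flip at
    [x] commute with the cleaning of its kids. *)
Lemma clean_set_spin n y w x b : (depth x < depth y)%N ->
  clean n y (set_spin w x b) = set_spin (clean n y w) x b.
Proof.
elim: n y w => [//|n IH] y w xy.
have dz z : z \in kids y -> (depth x < depth z)%N.
  by move=> zy; rewrite [depth z](depth_kids zy) ltnW.
rewrite /= foldr_clean_set_spin//; set w' := foldr _ _ _.
have -> : count (fun z => ~~ set_spin w' x b z) (kids y) =
    count (fun z => ~~ w' z) (kids y).
  apply: eq_in_count => z zy; rewrite set_spin_neq//.
  by apply: contraTneq (dz _ zy) => ->; rewrite ltnn.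
case: ifP => // _; rewrite set_spinC//.
by apply: contraTneq xy => ->; rewrite ltnn.
Qed.

Lemma kids_foldr_clean_set_spin n x w b :
  foldr (clean n) (set_spin w x b) (kids x) = set_spin (foldr (clean n) w (kids x)) x b.
Proof.
apply: foldr_clean_set_spin; first by move=> y u xy; exact: clean_set_spin.
by move=> y yx; rewrite [depth y](depth_kids yx).
Qed.

Lemma constraintE x w : constraint N j x w = (j <= count (fun y => ~~ w y) (N x))%N.
Proof.
rewrite /constraint; congr (j <= _)%N; elim: (N x) => [|y s IH]; first by rewrite big_nil.
by rewrite big_cons IH /=; case: (w y).
Qed.

Lemma constraint_kids x w : (j <= count (fun y => ~~ w y) (kids x))%N ->
  constraint N j x w.
Proof.
rewrite constraintE => /leq_trans; apply.
rewrite -!size_filter; apply: uniq_leq_size; first by rewrite filter_uniq// kids_uniq.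
by move=> z; rewrite !mem_filter => /andP[-> /=]; exact: kids_nbrs.
Qed.

(** A neighbor that is not a kid is a parent, here occupied, so all empty neighbors are kids. *)
Lemma kids_constraint x w : (forall y, x \in kids y -> w y) -> constraint N j x w ->
  (j <= count (fun y => ~~ w y) (kids x))%N.
Proof.
move=> wp; rewrite constraintE => /leq_trans; apply.
rewrite -!size_filter; apply: uniq_leq_size; first by rewrite filter_uniq// (nbrs_uniq T).
move=> z; rewrite !mem_filter => /andP[wz /(nbrs_kids T)[|/wp]].
  by rewrite wz.
by rewrite (negbTE wz).
Qed.

Lemma notin_kids x : x \notin kids x.
Proof.
apply/negP => xx; have := depth_kids xx.
by move=> /eqP; rewrite -[X in X == _]addn0 -addn1 eqn_add2l.
Qed.

(* Legality leaves [x] not blocked whatever its spin, unless its parent is empty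
   and hence not blocked either. *)
Lemma blocked_legal n x y w b : constraint N j x w ->
  (forall z, y \in kids z -> w z) -> x \notin level n y ->
  blocked n.+1 y (set_spin w x b) = blocked n.+1 y w.
Proof.
move=> cx; elim: n y => [|n IH] y wp.
  by rewrite inE eq_sym => yx; rewrite /= set_spin_neq.
move=> xl; rewrite [LHS]/= [RHS]/=; rewrite -/blocked.
have [yx|yx] := eqVneq y x.
  (* At [x] itself, legality provides [j] empty kids; these are not blocked, so [x] is unblocked
     under both spins. *)
  subst y; have := kids_constraint wp cx => /= cj.
  have F w' : {in kids x, forall z, w' z = w z} ->
      (count (fun z => ~~ blocked n.+1 z w') (kids x) < j)%N = false.
    move=> ww'; apply/negbTE; rewrite -leqNgt (leq_trans cj)//.
    rewrite -!size_filter; apply: uniq_leq_size; first by rewrite filter_uniq// kids_uniq.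
    move=> z; rewrite !mem_filter => /andP[wz zx]; rewrite zx andbT.
    by rewrite negb_and ww'// wz.
  have F1 := F w (fun _ _ => erefl).
  have F2 : (count (fun z => ~~ blocked n.+1 z (set_spin w x b)) (kids x) < j)%N = false.
    apply: F => z zx; rewrite set_spin_neq//.
    by apply: contraTneq zx => ->; exact: notin_kids.
  by rewrite F1 F2 !andbF.
(* An empty [y] is unblocked in both configurations; an occupied [y] is the occupied parent that the
   induction needs at its kids. *)
rewrite set_spin_neq//; case: (boolP (w y)) => //= wy.
congr (_ < j)%N; apply: eq_in_count => z zy; congr (~~ _).
apply: IH => [z' /parent_kids <-|]; first by rewrite (parent_kids zy).
by apply: contra xl => xl; apply/flatten_mapP; exists z.
Qed.

End Tree.

(** * Blocking probabilities and moments of the pivotal count *)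

Section BlockedProbability.
Context (R : realType) (V : countType) (k j : nat) (N : V -> seq V) (T : rooting k N).
Hypothesis j_gt0 : (0 < j)%N.
Context (p : R).
Hypothesis p01 : 0 <= p <= 1.
Implicit Types (w : config V) (x y z : V).

Let p0 : 0 <= p. Proof. by case/andP: p01. Qed.
Let p1 : p <= 1. Proof. by case/andP: p01. Qed.

Local Notation kids := (kids T).
Local Notation depth := (depth T).
Local Notation blocked := (blocked j T).
Local Notation zone := (zone T).
Local Notation level := (level T).
Local Notation E := (expect p).
Local Notation lam := (occupation k j p).

Let unblocked n s w := count (fun z => ~~ blocked n z w) s.

Lemma unblocked_depends n s : depends_on (flatten [seq zone n z | z <- s]) (unblocked n s).
Proof.
move=> w w' ww'; apply: eq_in_count => z zs; congr (~~ _).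
by apply: blocked_depends => x xz; apply: ww'; apply/flatten_mapP; exists z.
Qed.

Lemma expect_occupied y : E (fun w => (w y)%:R) = p.
Proof.
rewrite (expect_set_spin p01 y); last first.
  by apply: local_bool; exact: depends_on_coord.
rewrite (_ : (fun _ => _) = fun=> 1); last by apply/funext => w; rewrite set_spin_eq.
rewrite expect_cst (_ : (fun _ => _) = fun=> 0); last first.
  by apply/funext => w; rewrite set_spin_eq.
by rewrite expect_cst; ring.
Qed.

(** Vertices of equal depth have disjoint zones, hence are blocked independently; conditioning on
    the head of [s] reproduces [binomial_tailS]. *)
Let expect_unblocked_aux n s m d l : uniq s -> {in s, forall z, depth z = d} ->
  {in s, forall z, E (fun w => (blocked n z w)%:R) = l} ->
  E (fun w => (unblocked n s w < m)%N%:R) = binomial_tail (size s) m l.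
Proof.
elim: s m => [|z s IH] m /=.
  by move=> _ _ _; rewrite expect_cst binomial_tail0.
move=> /andP[zs us] sd sE.
have zE : E (fun w => (blocked n z w)%:R) = l by apply: sE; rewrite mem_head.
have {}IH m' : E (fun w => (unblocked n s w < m')%N%:R) = binomial_tail (size s) m' l.
  by apply: IH => // z' zs'; [apply: sd|apply: sE]; rewrite inE zs' orbT.
have lz : local_function (fun w => (blocked n z w)%:R : R).
  by apply: local_bool; exact: blocked_depends.
have ls m' : local_function (fun w => (unblocked n s w < m')%N%:R : R).
  apply: local_bool; apply: (@depends_on_comp _ _ _ _ (fun c => c < m')%N).
  exact: unblocked_depends.
have lz' : local_function (fun w => 1 - (blocked n z w)%:R : R).
  by apply: localB => //; exact: local_cst.
rewrite (_ : (fun w => _) = (fun w =>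
    (blocked n z w)%:R * (unblocked n s w < m)%N%:R +
    (1 - (blocked n z w)%:R) * (unblocked n s w < m.-1)%N%:R)); last first.
  apply/funext => w; rewrite /unblocked/=; set c := count _ _.
  case: (blocked n z w) => /=; first by rewrite add0n mul1r subrr mul0r addr0.
  by rewrite add1n mul0r subr0 mul1r add0r; case: (m).
have disj : {in zone n z, forall x, x \notin flatten [seq zone n z | z <- s]}.
  move=> x xz; apply/negP => /flatten_mapP[z' zs' xz'].
  have := zone_disjoint _ xz xz'; rewrite !sd ?inE ?eqxx ?zs' ?orbT// => /(_ erefl) zz'.
  by rewrite zz' zs' in zs.
rewrite expectD; [|exact: localM|exact: localM].
have dz : depends_on (zone n z) (fun w => (blocked n z w)%:R : R).
  by apply: (@depends_on_comp _ _ _ _ (fun b : bool => b%:R)); exact: blocked_depends.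
have dz' : depends_on (zone n z) (fun w => 1 - (blocked n z w)%:R : R).
  by apply: (@depends_on_comp _ _ _ _ (fun b : bool => 1 - b%:R)); exact: blocked_depends.
have ds m' : depends_on (flatten [seq zone n z | z <- s])
    (fun w => (unblocked n s w < m')%N%:R : R).
  by apply: (@depends_on_comp _ _ _ _ (fun c => (c < m')%N%:R)); exact: unblocked_depends.
rewrite (expectM p01 dz (ds _))// (expectM p01 dz' (ds _))//.
rewrite expectB//; last exact: local_cst.
by rewrite expect_cst zE !IH binomial_tailS.
Qed.

Let kids_gt0 x z : z \in kids x -> (0 < depth z)%N.
Proof. by move=> /depth_kids ->. Qed.

Lemma coord_depends y : depends_on [:: y] (fun w => (w y)%:R : R).
Proof.
apply: (@depends_on_comp _ _ _ _ (fun b : bool => b%:R) (fun w => w y)).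
exact: depends_on_coord.
Qed.

Let zone_kids_flatten n y s : {subset s <= kids y} ->
  {in [:: y], forall x, x \notin flatten [seq zone n z | z <- s]}.
Proof.
move=> sy x; rewrite inE => /eqP ->; apply/negP => /flatten_mapP[z /sy zy].
by apply/negP; exact: zone_kid.
Qed.

(** Positive depth ensures exactly [k] kids, whereas the root may have more. *)
Lemma expect_blocked n y : (0 < depth y)%N -> E (fun w => (blocked n y w)%:R) = lam n.
Proof.
elim: n y => [|n IH] y dy; first by rewrite expect_cst.
rewrite (_ : (fun w => _) = (fun w => (w y)%:R * (unblocked n (kids y) w < j)%N%:R)); last first.
  by apply/funext => w; rewrite /= -natrM mulnb.
rewrite (@expectM _ _ _ p01 [:: y] (flatten [seq zone n z | z <- kids y])).
- rewrite expect_occupied (@expect_unblocked_aux n _ j (depth y).+1 (lam n)) ?size_kids//.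
  + exact: kids_uniq.
  + by move=> z /depth_kids.
  + by move=> z /kids_gt0; exact: IH.
- exact: coord_depends.
- by apply: (@depends_on_comp _ _ _ _ (fun c => (c < j)%N%:R)); exact: unblocked_depends.
- exact: zone_kids_flatten.
Qed.

Lemma expect_unblocked n s m d : uniq s -> {in s, forall z, depth z = d.+1} ->
  E (fun w => (unblocked n s w < m)%N%:R) = binomial_tail (size s) m (lam n).
Proof.
move=> us sd; apply: (@expect_unblocked_aux _ _ _ d.+1) => // z zs.
by rewrite expect_blocked// sd.
Qed.

(* Dominates the number of boundary sites whose spin decides [blocked n.+1 y]. *)
Fixpoint pivotal n y w : R :=
  if n is n'.+1 then
    (w y)%:R * \sum_(z <- kids y)
      (count (fun z' => ~~ blocked n z' w) [seq z' <- kids y | z' != z] == j.-1)%:R *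
      pivotal n' z w
  else 1.

Lemma pivotal_ge0 n y w : 0 <= pivotal n y w.
Proof.
elim: n y => [|n IH] y //=; rewrite mulr_ge0//; apply: sumr_ge0 => z _.
by rewrite mulr_ge0.
Qed.

Let others_depends n y z : depends_on
  (flatten [seq zone n z' | z' <- [seq z' <- kids y | z' != z]])
  (fun w => (count (fun z' => ~~ blocked n z' w) [seq z' <- kids y | z' != z] == j.-1)%:R : R).
Proof.
by apply: (@depends_on_comp _ _ _ _ (fun c => (c == j.-1)%:R)); exact: unblocked_depends.
Qed.

Lemma pivotal_depends n y : depends_on (zone n.+1 y) (pivotal n y).
Proof.
elim: n y => [//|n IH] y w w' ww' /=.
rewrite ww' ?mem_head//; congr (_ * _); apply: eq_big_seq => z zy.
congr (_ * _); last by apply: IH => x xz; apply: ww'; apply: zone_cons xz.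
apply: (@others_depends n.+1) => x /flatten_mapP[z']; rewrite mem_filter => /andP[_ zy'] xz'.
by apply: ww'; exact: zone_cons xz'.
Qed.

Lemma local_pivotal n y : local_function (pivotal n y).
Proof. by exists (zone n.+1 y); exact: pivotal_depends. Qed.

Lemma count_others (a : pred V) s z : uniq s -> z \in s ->
  count a s = (a z + count a [seq z' <- s | z' != z])%N.
Proof.
move=> us zs; rewrite (permP (perm_to_rem zs) a)/= rem_filter//.
Qed.

(** A boundary site below the kid [z] can decide [y] only if it decides [z], [y] is occupied, and
    exactly [j.-1] of the other kids are unblocked. Summing over [z] gives the recursion of
    [pivotal]. *)
Lemma sum_level_pivotal n y w :
  \sum_(x <- level n y) (blocked n.+1 y (set_spin w x true) !=
                         blocked n.+1 y (set_spin w x false))%:R <= pivotal n y w.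
Proof.
elim: n y => [|n IH] y; first by rewrite big_seq1 /pivotal; case: (_ != _).
rewrite [level _ _]/= big_flatten big_map [pivotal _ _ _]/= mulr_sumr big_seq [leRHS]big_seq.
apply: ler_sum => z zy; set I := (X in X%:R * pivotal _ _ _).
rewrite mulrA -natrM mulnb (le_trans _ (ler_wpM2l _ (IH z)))//.
rewrite mulr_sumr big_seq [leRHS]big_seq; apply: ler_sum => x xz.
rewrite -natrM ler_nat mulnb.
have xz' := level_zone xz.
have xy : y != x.
  by apply: contraTneq xz' => <-; exact: zone_kid.
(* The flip at [x] affects only the kid [z] above it, the zones of the other kids being disjoint
   from that of [z]. *)
have H b : blocked n.+2 y (set_spin w x b) = w y &&
    (~~ blocked n.+1 z (set_spin w x b) +
     count (fun z' => ~~ blocked n.+1 z' w) [seq z' <- kids y | z' != z] < j)%N.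
  rewrite [LHS]/= -/(blocked n.+1 _ _) set_spin_neq//; congr (_ && (_ < j)%N).
  rewrite (count_others _ (kids_uniq T y) zy); congr (_ + _)%N.
  apply: eq_in_count => z'; rewrite mem_filter => /andP[zz' zy'].
  congr (~~ _); apply: depends_on_set_spin; first exact: blocked_depends.
  apply/negP => /(zone_disjoint _ xz') E; move: zz'; rewrite E ?eqxx//.
  by rewrite (depth_kids zy) (depth_kids zy').
rewrite !H /I {H}; set c := count _ [seq _ <- _ | _].
move: c (blocked n.+1 z (set_spin w x true)) (blocked n.+1 z (set_spin w x false)).
move=> c b1 b2; case: (w y) => //=.
have cE : (((c < j) != (c.+1 < j)) <= (c == j.-1))%N.
  have [->|cj] := eqVneq c j.-1; first exact: leq_b1.
  by rewrite leqn0 eqb0 negbK; apply/eqP; move: j_gt0 cj; clear; lia.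
case: b1; case: b2; rewrite ?eqxx//= ?add0n ?add1n ?andbT//.
by rewrite eq_sym.
Qed.

(** The slope of [g_p] at [l_(n+1)]: the mean growth of the pivotal count over one generation. *)
Let gain n : R := p * dbinomial_tail k j (lam n.+1).

Fixpoint pivotal_mean n : R := if n is n'.+1 then gain n' * pivotal_mean n' else 1.

(** Only an upper bound of the second moment: the diagonal is multiplied by [gain], and pairs of
    distinct kids are bounded by the squared mean. *)
Fixpoint pivotal_second_moment n : R :=
  if n is n'.+1 then
    gain n' * pivotal_second_moment n' + k%:R ^+ 2 * pivotal_mean n' ^+ 2
  else 1.

Let others n y z w :=
  count (fun z' => ~~ blocked n z' w) [seq z' <- kids y | z' != z].

Let size_others y z : (0 < depth y)%N -> z \in kids y ->
  size [seq z' <- kids y | z' != z] = k.-1.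
Proof.
move=> dy zy; rewrite -(rem_filter _ (kids_uniq T y)) size_rem// size_kids//.
Qed.

Let expect_others n y z : (0 < depth y)%N -> z \in kids y ->
  E (fun w => (others n y z w == j.-1)%:R) =
  binomial_tail k.-1 j (lam n) - binomial_tail k.-1 j.-1 (lam n).
Proof.
move=> dy zy.
rewrite (_ : (fun _ => _) = fun w =>
    (others n y z w < j)%N%:R - (others n y z w < j.-1)%N%:R :> R); last first.
  apply/funext => w; rewrite -[in (_ < j)%N](prednK j_gt0) ltnS.
  by case: ltngtP; rewrite ?subrr ?subr0.
have lo m : local_function (fun w => (others n y z w < m)%N%:R : R).
  apply: local_bool; apply: (@depends_on_comp _ _ _ _ (fun c => c < m)%N).
  exact: unblocked_depends.
rewrite expectB// !(@expect_unblocked n _ _ (depth y)) ?size_others//.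
- by rewrite filter_uniq// kids_uniq.
- by move=> z'; rewrite mem_filter => /andP[_ /depth_kids].
- by rewrite filter_uniq// kids_uniq.
- by move=> z'; rewrite mem_filter => /andP[_ /depth_kids].
Qed.

Let others_disjoint n y z : z \in kids y ->
  {in flatten [seq zone n z' | z' <- [seq z' <- kids y | z' != z]],
   forall x, x \notin zone n z}.
Proof.
move=> zy x /flatten_mapP[z']; rewrite mem_filter => /andP[zz' zy'] xz'.
apply/negP => xz; move: zz'; rewrite (zone_disjoint _ xz' xz) ?eqxx//.
by rewrite (depth_kids zy) (depth_kids zy').
Qed.

Let local_others n y z : local_function (fun w => (others n y z w == j.-1)%:R : R).
Proof.
exists (flatten [seq zone n z' | z' <- [seq z' <- kids y | z' != z]]).
exact: others_depends.
Qed.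

(** The spin at [y], the zone of [z] and the zones of the other kids are disjoint, so each term
    factorizes; the [k] equal terms add up to the derivative. *)
Lemma expect_pivotal n y : (0 < depth y)%N -> E (pivotal n y) = pivotal_mean n.
Proof.
elim: n y => [|n IH] y dy; first by rewrite [LHS]expect_cst.
pose F z w := (others n.+1 y z w == j.-1)%:R * pivotal n z w.
have lF z : local_function (F z) by apply: localM; [exact: local_others|exact: local_pivotal].
rewrite [LHS](@expectM _ _ _ p01 [:: y] (flatten [seq zone n.+1 z | z <- kids y])
   (fun w => (w y)%:R) (fun w => \sum_(z <- kids y) F z w)).
- rewrite expect_occupied expect_sum//.
  under eq_big_seq => z zy.
    rewrite /F (expectM p01 (@others_depends n.+1 y z) (@pivotal_depends n z)); last first.
      exact: others_disjoint.
    rewrite expect_others// IH ?(kids_gt0 zy)//.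
    over.
  rewrite big_const_seq count_predT size_kids// iter_addr_0 -mulr_natl.
  by rewrite /= /gain /dbinomial_tail; ring.
- exact: coord_depends.
- move=> w w' ww'; apply: eq_big_seq => z zy; congr (_ * _).
    apply: others_depends => x /flatten_mapP[z']; rewrite mem_filter => /andP[_ zy'] xz'.
    by apply: ww'; apply/flatten_mapP; exists z'.
  by apply: pivotal_depends => x xz; apply: ww'; apply/flatten_mapP; exists z.
- exact: zone_kids_flatten.
Qed.

Lemma pivotal_mean_ge0 n : 0 <= pivotal_mean n.
Proof.
elim: n => //= n IH; rewrite mulr_ge0// mulr_ge0// dbinomial_tail_ge0//.
exact: (occupation01 k j n.+1 p01).
Qed.

(** The weights [a] are bounded by [1] off the diagonal but kept on it, where they supply the
    contraction factor. *)
Lemma sqr_sum_le (s : seq V) (a b : V -> R) : uniq s ->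
  (forall z, 0 <= a z <= 1) -> (forall z, 0 <= b z) ->
  (\sum_(z <- s) a z * b z) ^+ 2 <=
  \sum_(z <- s) a z * b z ^+ 2 + \sum_(z <- s) \sum_(z' <- s | z' != z) b z * b z'.
Proof.
move=> us a01 b0.
rewrite expr2 big_distrlr -big_split/= big_seq [leRHS]big_seq; apply: ler_sum => z zy.
rewrite (bigD1_seq z)//= lerD//.
  have -> : a z * b z * (a z * b z) = a z ^+ 2 * b z ^+ 2 by ring.
  rewrite ler_wpM2r ?sqr_ge0//; have /andP[] := a01 z.
  by rewrite expr2; nra.
apply: ler_sum => z' _; have /andP[? ?] := a01 z; have /andP[? ?] := a01 z'.
by apply: ler_pM; rewrite ?mulr_ge0//; exact: ler_piMl.
Qed.

Let diag n y w : R := \sum_(z <- kids y) (others n.+1 y z w == j.-1)%:R * pivotal n z w ^+ 2.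

Let offdiag n y w : R :=
  \sum_(z <- kids y) \sum_(z' <- kids y | z' != z) pivotal n z w * pivotal n z' w.

Let local_pivotal_sqr n z : local_function (fun w => pivotal n z w ^+ 2).
Proof. by apply: (local_comp (fun a => a ^+ 2)); exact: local_pivotal. Qed.

Let local_diag_term n y z :
  local_function (fun w => (others n.+1 y z w == j.-1)%:R * pivotal n z w ^+ 2).
Proof. by apply: localM; [exact: local_others|exact: local_pivotal_sqr]. Qed.

Let local_offdiag_term n z z' : local_function (fun w => pivotal n z w * pivotal n z' w).
Proof. by apply: localM; exact: local_pivotal. Qed.

Let pivotal_sqr_le n y w : pivotal n.+1 y w ^+ 2 <= (w y)%:R * (diag n y w + offdiag n y w).
Proof.
rewrite [pivotal _ _ _]/= exprMn -natrX.
rewrite (_ : (w y ^ 2)%N = w y); last by case: (w y).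
rewrite ler_wpM2l//; apply: sqr_sum_le; first exact: kids_uniq.
- by move=> z; case: (_ == _); rewrite /= ?lexx ?ler01.
- by move=> z; exact: pivotal_ge0.
Qed.

Let diag_offdiag_depends n y : depends_on (flatten [seq zone n.+1 z | z <- kids y])
  (fun w => diag n y w + offdiag n y w).
Proof.
move=> w w' ww'.
have Pw z : z \in kids y -> pivotal n z w = pivotal n z w'.
  by move=> zy; apply: pivotal_depends => x xz; apply: ww'; apply/flatten_mapP; exists z.
congr (_ + _); apply: eq_big_seq => z zy.
  rewrite Pw//; congr (_ * _).
  apply: others_depends => x /flatten_mapP[z']; rewrite mem_filter => /andP[_ zy'] xz'.
  by apply: ww'; apply/flatten_mapP; exists z'.
rewrite big_seq_cond [RHS]big_seq_cond; apply: eq_bigr => z' /andP[zy' _].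
by rewrite !Pw.
Qed.

Let expect_diag n y : (0 < depth y)%N ->
  (forall z, (0 < depth z)%N -> E (fun w => pivotal n z w ^+ 2) <= pivotal_second_moment n) ->
  p * E (diag n y) <= gain n * pivotal_second_moment n.
Proof.
move=> dy IH; rewrite expect_sum; last by move=> z _; exact: local_diag_term.
have occ := occupation01 k j n.+1 p01.
apply: (@le_trans _ _ (p * \sum_(z <- kids y)
  (binomial_tail k.-1 j (lam n.+1) - binomial_tail k.-1 j.-1 (lam n.+1)) *
   pivotal_second_moment n)).
  rewrite ler_wpM2l// big_seq [leRHS]big_seq; apply: ler_sum => z zy.
  rewrite (expectM p01 (@others_depends n.+1 y z) (S' := zone n.+1 z)); last 2 first.
  - by move=> w w' ww'; rewrite (pivotal_depends ww').
  - exact: others_disjoint.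
  rewrite expect_others//; apply: ler_wpM2l; last by apply: IH; exact: kids_gt0 zy.
  by rewrite subr_ge0 binomial_tail_leW ?leq_pred.
rewrite big_const_seq count_predT size_kids// iter_addr_0 -[X in p * X]mulr_natl.
move: (pivotal_second_moment n) => M; rewrite /gain /dbinomial_tail.
by move: (binomial_tail _ _ _) (binomial_tail _ _ _) => a b; rewrite !mulrA lexx.
Qed.

Let expect_offdiag n y : (0 < depth y)%N ->
  p * E (offdiag n y) <= k%:R ^+ 2 * pivotal_mean n ^+ 2.
Proof.
move=> dy; rewrite expect_sum; last first.
  by move=> z _; apply: local_sum => z' _; exact: local_offdiag_term.
apply: (@le_trans _ _ (1 * \sum_(z <- kids y) \sum_(z' <- kids y) pivotal_mean n ^+ 2)).
  apply: ler_pM => //; first by apply: sumr_ge0 => z _; apply: expect_ge0 => w;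
    apply: sumr_ge0 => z' _; rewrite mulr_ge0 ?pivotal_ge0.
  rewrite big_seq [leRHS]big_seq; apply: ler_sum => z zy.
  rewrite expect_sum; last by move=> z' _; exact: local_offdiag_term.
  rewrite [leRHS](bigID (fun z' => z' != z))/= -[leLHS]addr0 lerD//; last first.
    by apply: sumr_ge0 => z' _; exact: sqr_ge0.
  rewrite big_seq_cond [leRHS]big_seq_cond; apply: ler_sum => z' /andP[zy' zz'].
  rewrite (expectM p01 (@pivotal_depends n z) (@pivotal_depends n z')).
    by rewrite !expect_pivotal ?(kids_gt0 zy) ?(kids_gt0 zy').
  move=> x xz; apply/negP => xz'; move: zz'; rewrite (zone_disjoint _ xz' xz) ?eqxx//.
  by rewrite (depth_kids zy) (depth_kids zy').
rewrite mul1r !big_const_seq !count_predT size_kids// !iter_addr_0.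
by rewrite -mulrnA -[leLHS]mulr_natl natrM -expr2 lexx.
Qed.

Lemma expect_pivotal_sqr n y : (0 < depth y)%N ->
  E (fun w => pivotal n y w ^+ 2) <= pivotal_second_moment n.
Proof.
elim: n y => [|n IH] y dy; first by rewrite /pivotal expr1n expect_cst.
have ld : local_function (diag n y).
  by apply: local_sum => z _; exact: local_diag_term.
have lo : local_function (offdiag n y).
  by apply: local_sum => z _; apply: local_sum => z' _; exact: local_offdiag_term.
have lw : local_function (fun w => (w y)%:R : R) by exists [:: y]; exact: coord_depends.
have := expect_le p (local_pivotal_sqr n.+1 y) (localM lw (localD ld lo)) (pivotal_sqr_le n y).
move=> /le_trans; apply.
rewrite (expectM p01 (@coord_depends y) (@diag_offdiag_depends n y)); last first.
  exact: zone_kids_flatten.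
rewrite expect_occupied expectD// mulrDr.
exact: lerD (expect_diag dy (fun z dz => IH z dz)) (expect_offdiag n dy).
Qed.

End BlockedProbability.

(** Eventually [rho n] is below some [s < 1] and [c n] is small, so [a] is dominated by a geometric
    sequence plus [e / 2]. *)
Lemma contraction_cvg0 (R : realType) (a rho c : R^nat) (r : R) :
  (forall n, 0 <= a n) -> (forall n, 0 <= rho n) ->
  (forall n, a n.+1 <= rho n * a n + c n) ->
  rho @ \oo --> r -> r < 1 -> c @ \oo --> 0 -> a @ \oo --> 0.
Proof.
move=> a0 rho0 ac rhor r1 c0.
pose s := (1 + r) / 2; have rs : r < s by rewrite /s; lra.
have s1 : s < 1 by rewrite /s; lra.
apply/cvgrPdist_le => e e0.
(* With this bound on the error, [e / 2] is the fixed point of the affine recursion of slope [s]. *)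
have d0 : 0 < e * (1 - s) / 2 by rewrite divr_gt0// mulr_gt0// subr_gt0.
have [M _ HM] : \forall n \near \oo, rho n <= s by apply: (cvgr_le r).
have [M' _ HM'] : \forall n \near \oo, c n <= e * (1 - s) / 2 by apply: (cvgr_le 0).
pose M'' := maxn M M'.
have s0 : 0 <= s by rewrite (le_trans (rho0 M))// HM/=.
have H m : a (m + M'')%N <= s ^+ m * a M'' + e / 2.
  elim: m => [|m IH]; first by rewrite add0n mul1r lerDl divr_ge0// ltW.
  rewrite addSn (le_trans (ac _))//.
  have h1 : rho (m + M'')%N <= s by apply: HM; rewrite /= /M''; lia.
  have h2 : c (m + M'')%N <= e * (1 - s) / 2 by apply: HM'; rewrite /= /M''; lia.
  have h3 : rho (m + M'')%N * a (m + M'')%N <= s * (s ^+ m * a M'' + e / 2).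
    by apply: ler_pM.
  rewrite exprS; lra.
have [M3 _ HM3] : \forall n \near \oo, s ^+ n * a M'' <= e / 2.
  have : (fun n => s ^+ n * a M'') @ \oo --> 0 * a M''.
    by apply: cvgMl; apply: cvg_expr; rewrite ger0_norm.
  by rewrite mul0r => /cvgr_le; apply; rewrite divr_gt0.
exists (M3 + M'')%N => // n /= nM.
rewrite sub0r normrN ger0_norm//.
have := H (n - M'')%N; rewrite subnK; last by lia.
have : s ^+ (n - M'') * a M'' <= e / 2 by apply: HM3 => /=; lia.
lra.
Qed.

(** Two contractions with the same limiting factor: first the mean, without error term, then the
    second moment, whose error is a multiple of the squared mean. *)
Lemma pivotal_second_moment_cvg0 (R : realType) (k j : nat) (p L : R) :
  0 <= p <= 1 ->
  occupation k j p @ \oo --> L -> p * dbinomial_tail k j L < 1 ->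
  pivotal_second_moment k j p @ \oo --> 0.
Proof.
move=> p01 oL L1.
have p0 : 0 <= p by case/andP: p01.
pose rho n := p * dbinomial_tail k j (occupation k j p n.+1).
have rho0 n : 0 <= rho n.
  by rewrite mulr_ge0// dbinomial_tail_ge0//; exact: (occupation01 k j n.+1 p01).
have rhoL : rho @ \oo --> p * dbinomial_tail k j L.
  apply: cvgMr; apply: (@cvg_comp _ _ _ (fun n => occupation k j p n.+1)
    (dbinomial_tail k j) _ (nbhs L)).
    by rewrite (cvg_shiftS (occupation k j p)).
  apply: cvgMr; apply: cvgB; exact: continuous_binomial_tail.
have m0 := pivotal_mean_ge0 k j p01.
have mc : pivotal_mean k j p @ \oo --> 0.
  apply: (@contraction_cvg0 _ _ rho (fun=> 0) (p * dbinomial_tail k j L)) => //.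
    by move=> n; rewrite addr0.
  exact: cvg_cst.
have M0 n : 0 <= pivotal_second_moment k j p n.
  elim: n => //= n IH; rewrite addr_ge0//; first exact: mulr_ge0 (rho0 n) IH.
  by rewrite mulr_ge0// sqr_ge0.
apply: (@contraction_cvg0 _ _ rho (fun n => k%:R ^+ 2 * pivotal_mean k j p n ^+ 2)
  (p * dbinomial_tail k j L)) => //.
rewrite -[X in _ --> X](mulr0 (k%:R ^+ 2)); apply: cvgMr.
rewrite -[X in _ --> X](mulr0 0) (_ : (fun n => _) =
  pivotal_mean k j p \* pivotal_mean k j p); last by apply/funext => n /=; rewrite expr2.
exact: cvgM.
Qed.

(** * Convergence in L2 *)

Section SquareIntegral.
Context d (T : measurableType d) (R : realType) (mu : probability T R).
Implicit Types (f g : T -> R) (u : nat -> T -> R).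

(** Meant for nonnegative [h], where additivity and monotonicity do not require integrability. *)
Definition nnint (h : T -> R) : \bar R := (\int[mu]_w (h w)%:E)%E.

Lemma le_nnint f g : measurable_fun setT f -> measurable_fun setT g ->
  (forall w, 0 <= f w) -> (forall w, f w <= g w) -> (nnint f <= nnint g)%E.
Proof.
move=> mf mg f0 fg; apply: ge0_le_integral => //.
- by move=> w _; rewrite lee_fin.
- exact/measurable_EFinP.
- exact/measurable_EFinP.
- by move=> w _; rewrite lee_fin.
Qed.

Lemma nnintD f g : measurable_fun setT f -> measurable_fun setT g ->
  (forall w, 0 <= f w) -> (forall w, 0 <= g w) ->
  (nnint (fun w => f w + g w)%R = nnint f + nnint g)%E.
Proof.
move=> mf mg f0 g0; rewrite /nnint; under eq_integral do rewrite EFinD.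
rewrite ge0_integralD//; do ?[exact/measurable_EFinP|by move=> w _; rewrite lee_fin].
Qed.

Lemma nnintZ c f : measurable_fun setT f -> (forall w, 0 <= f w) -> 0 <= c ->
  (nnint (fun w => c * f w)%R = c%:E * nnint f)%E.
Proof.
move=> mf f0 c0; rewrite /nnint; under eq_integral do rewrite EFinM.
rewrite ge0_integralZl//; do ?[exact/measurable_EFinP|by move=> w _; rewrite lee_fin].
Qed.

Lemma nnint_ge0 f : (forall w, 0 <= f w) -> (0 <= nnint f)%E.
Proof. by move=> f0; apply: integral_ge0 => w _; rewrite lee_fin. Qed.

Lemma nnint_eq0_ae f : measurable_fun setT f -> (forall w, 0 <= f w) ->
  (nnint f <= 0)%E -> \forall w \ae mu, f w = 0.
Proof.
move=> mf f0 fint; have mf' : measurable_fun setT (EFin \o f) by exact/measurable_EFinP.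
have : (\int[mu]_(w in setT) `|(EFin \o f) w| = 0)%E.
  apply/eqP; rewrite eq_le; apply/andP; split; last exact: integral_ge0.
  by under eq_integral do rewrite /= ger0_norm//.
move=> /(ae_eq_integral_abs mu measurableT mf'); apply: filterS => w /(_ I) /=.
by move=> [].
Qed.

Lemma Lnorm2E f : ('N[mu]_2%:E[EFin \o f] = nnint (fun w => f w ^+ 2)%R `^ 2^-1)%E.
Proof.
rewrite unlock; congr (_ `^ _)%E; apply: eq_integral => w _.
by rewrite poweR_EFin powR_mulrn// real_normK// num_real.
Qed.

(** Together with [nnint_L2_cvg], trades norms for integrals of squares, in which all later
    estimates are stated. *)
Lemma L2_cvg_nnint u f : L2_cvg mu u f -> forall e, 0 < e ->
  \forall n \near \oo, (nnint (fun w => (u n w - f w) ^+ 2)%R <= e%:E)%E.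
Proof.
move=> /fine_cvgP[fin cvg0] e e0.
have se : 0 < Num.sqrt e by rewrite sqrtr_gt0.
near=> n.
have fn : ('N[mu]_2%:E[EFin \o (u n \- f)%R])%E \is a fin_num by near: n.
have : fine ('N[mu]_2%:E[EFin \o (u n \- f)%R])%E <= Num.sqrt e.
  near: n; exact: cvgr_le cvg0 _ se.
have := @poweR_Lnorm _ _ _ mu (EFin \o (u n \- f)%R) 2 (ltac:(by [])).
have -> : (\int[mu]_x (`|(EFin \o (u n \- f)%R) x| `^ 2))%E =
    nnint (fun w => (u n w - f w) ^+ 2).
  by apply: eq_integral => w _; rewrite [(`|_|)%E]/= poweR_EFin powR_mulrn// real_normK// num_real.
move=> <-; have := Lnorm_ge0 mu 2%:E (EFin \o (u n \- f)%R).
move: fn; case: (Lnorm mu 2%:E _) => [r| |]//= _; rewrite lee_fin => r0 re.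
rewrite powR_mulrn// lee_fin -(sqr_sqrtr (ltW e0)).
by apply: lerXn2r; rewrite ?nnegrE// ltW.
Unshelve. all: by end_near. Qed.

Lemma nnint_L2_cvg u f (s : R^nat) :
  (forall n, (nnint (fun w => (u n w - f w) ^+ 2)%R <= (s n)%:E)%E) ->
  s @ \oo --> 0 -> L2_cvg mu u f.
Proof.
move=> us s0; rewrite /L2_cvg.
have sge0 n : 0 <= s n.
  by rewrite -lee_fin (le_trans _ (us n))// nnint_ge0// => w; exact: sqr_ge0.
apply: (@squeeze_cvge _ _ _ _ (cst 0%E) _ (fun n => (Num.sqrt (s n))%:E)).
- apply: nearW => n; rewrite Lnorm_ge0/= Lnorm2E.
  rewrite -powR12_sqrt// -poweR_EFin; apply: gt0_ler_poweR => //.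
  + by rewrite in_itv/= leey andbT nnint_ge0// => w; exact: sqr_ge0.
  + by rewrite in_itv/= leey andbT lee_fin.
  + exact: us.
- exact: cvg_cst.
- apply/fine_cvgP; split; first by apply: nearW.
  rewrite -[X in _ --> X]sqrtr0.
  exact: (@continuous_cvg _ _ _ _ _ s Num.sqrt 0 (@sqrt_continuous R 0) s0).
Qed.

Lemma Lfun2P f : f \in Lfun mu 2%:E <->
  measurable_fun setT f /\ (nnint (fun w => f w ^+ 2)%R < +oo)%E.
Proof.
split=> [lf|[mf fi]].
  have /andP[] := lf; rewrite !inE/= => mf _; split=> //.
  have /integrableP[_] := Lfun2_integrable_sqr lf.
  rewrite /nnint; under eq_integral do rewrite /= ger0_norm ?sqr_ge0//.
  by [].
apply/andP; rewrite !inE/=; split=> //.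
rewrite /finite_norm Lnorm2E.
by apply: poweR_lty.
Qed.

End SquareIntegral.

(** * The Dirichlet form and the kernel of the generator *)

Section DirichletForm.
Context (R : realType) (V : countType) (k j : nat) (N : V -> seq V) (T : rooting k N).
Context (p : R).
Hypothesis p01 : 0 <= p <= 1.
Implicit Types (w : config V) (x y z : V) (u f : config V -> R).

Local Notation E := (expect p).
Local Notation c x := (constraint N j x).
Local Notation L := (generator N j p).
Local Notation mu := (bernoulli_product V p).

Let p0 : 0 <= p. Proof. by case/andP: p01. Qed.
Let q0 : 0 <= 1 - p. Proof. by rewrite subr_ge0; case/andP: p01. Qed.

(** Averaging at a site outside the support does not change [u], so its term vanishes. *)
Lemma generatorE S u w : depends_on S u ->
  L u w = \sum_(x <- undup S) (c x w)%:R * (site_average p x u w - u w).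
Proof.
move=> uS; rewrite /generator (fsbig_seq _ _ (undup_uniq S)).
apply/esym/fsbig_widen => // x [_ /= xS].
have {}xS : x \notin S by apply/negP => xS'; apply: xS; rewrite mem_undup.
by rewrite /site_average !(depends_on_set_spin _ _ uS)//; ring.
Qed.

Lemma constraint_depends x : depends_on (N x) (c x).
Proof. by move=> w w' ww'; congr (j <= _)%N; apply: eq_big_seq => y /ww' ->. Qed.

Lemma local_constraint x : local_function (fun w => (c x w)%:R : R).
Proof. by apply: local_bool; exact: constraint_depends. Qed.

Lemma notin_nbrs x : x \notin N x.
Proof.
apply/negP => /(nbrs_kids T) xx; have : x \in kids T x by case: xx.
by apply/negP; exact: notin_kids.
Qed.

Lemma constraint_set_spin x w b : c x (set_spin w x b) = c x w.
Proof. apply: depends_on_set_spin (notin_nbrs x); exact: constraint_depends. Qed.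

Lemma local_generator_term x u : local_function u ->
  local_function (fun w => (c x w)%:R * (site_average p x u w - u w)).
Proof.
move=> lu; apply: localM; first exact: local_constraint.
by apply: localB => //; exact: local_site_average.
Qed.

Lemma local_generator u : local_function u -> local_function (L u).
Proof.
move=> /[dup] lu [S uS].
rewrite (_ : L u = fun w => \sum_(x <- undup S) (c x w)%:R * (site_average p x u w - u w)).
  by apply: local_sum => x _; exact: local_generator_term.
by apply/funext => w; exact: generatorE.
Qed.

Let local_grad x u : local_function u ->
  local_function (fun w => (c x w)%:R * (u (set_spin w x true) - u (set_spin w x false)) ^+ 2).
Proof.
move=> lu; apply: localM; first exact: local_constraint.
by apply: (local_comp (fun a => a ^+ 2)); apply: localB; exact: local_set_spin.
Qed.

(** Integration by parts at one site: the constraint at [x] ignores the spin at [x], so conditioning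
    on that spin produces a variance. *)
Lemma expect_generator_term x u : local_function u ->
  E (fun w => - u w * ((c x w)%:R * (site_average p x u w - u w))) =
  p * (1 - p) * E (fun w =>
    (c x w)%:R * (u (set_spin w x true) - u (set_spin w x false)) ^+ 2).
Proof.
move=> lu.
have lt := local_generator_term x lu.
have lg := local_grad x lu.
rewrite (expect_set_spin p01 x); last by apply: localM => //; exact: localN.
pose g w := (c x w)%:R * (u (set_spin w x true) - u (set_spin w x false)).
have E1 : (fun w => - u (set_spin w x true) * ((c x (set_spin w x true))%:R *
    (site_average p x u (set_spin w x true) - u (set_spin w x true)))) =
  fun w => (1 - p) * (g w * u (set_spin w x true)).
  by apply/funext => w; rewrite constraint_set_spin /site_average !set_spinK /g; ring.
have E2 : (fun w => - u (set_spin w x false) * ((c x (set_spin w x false))%:R *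
    (site_average p x u (set_spin w x false) - u (set_spin w x false)))) =
  fun w => - p * (g w * u (set_spin w x false)).
  by apply/funext => w; rewrite constraint_set_spin /site_average !set_spinK /g; ring.
have lgu b : local_function (fun w => g w * u (set_spin w x b)).
  apply: localM; last exact: local_set_spin.
  by apply: localM; [exact: local_constraint|apply: localB; exact: local_set_spin].
rewrite E1 E2 !expectZ//.
rewrite (_ : (fun w => _ * _ ^+ 2) =
  fun w => g w * u (set_spin w x true) - g w * u (set_spin w x false)); last first.
  by apply/funext => w; rewrite /g; ring.
by rewrite expectB//; ring.
Qed.

(** One site contributes at most the whole Dirichlet form, the expectation of [- u * L u], which the
    weighted inequality between products and squares bounds. The weight [e] allows for bounded [u]
    and small [L u]. *)
Lemma dirichlet_le x u (e : R) : local_function u -> 0 < e ->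
  p * (1 - p) * E (fun w =>
    (c x w)%:R * (u (set_spin w x true) - u (set_spin w x false)) ^+ 2) <=
  e / 2 * E (fun w => u w ^+ 2) + (2 * e)^-1 * E (fun w => L u w ^+ 2).
Proof.
move=> /[dup] lu [S uS] e0.
have lL := local_generator lu.
have lu2 : local_function (fun w => u w ^+ 2) by exact: (local_comp (fun a => a ^+ 2)).
have lL2 : local_function (fun w => L u w ^+ 2) by exact: (local_comp (fun a => a ^+ 2)).
have lr : local_function (fun w => e / 2 * u w ^+ 2 + (2 * e)^-1 * L u w ^+ 2).
  by apply: localD; apply: localM => //; exact: local_cst.
have luL : local_function (fun w => - u w * L u w).
  by apply: localM => //; exact: localN.
apply: (@le_trans _ _ (E (fun w => - u w * L u w))); last first.
  rewrite -!expectZ// -expectD; [|by apply: localM => //; exact: local_cst..].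
  apply: expect_le => // w.
  set a := u w; set b := L u w.
  have : 0 <= (e * a + b) ^+ 2 / (2 * e) by rewrite divr_ge0 ?sqr_ge0// mulr_ge0// ltW.
  have -> : (e * a + b) ^+ 2 / (2 * e) = e / 2 * a ^+ 2 + (2 * e)^-1 * b ^+ 2 + a * b.
    by field; rewrite gt_eqF.
  by lra.
rewrite (_ : (fun w => - u w * L u w) = fun w => \sum_(y <- undup S)
   - u w * ((c y w)%:R * (site_average p y u w - u w))); last first.
  by apply/funext => w; rewrite (generatorE w uS) mulr_sumr.
rewrite expect_sum; last first.
  by move=> y _; apply: localM; [exact: localN|exact: local_generator_term].
under eq_bigr => y _ do rewrite expect_generator_term//.
have ge0 y : 0 <= p * (1 - p) * E (fun w =>
    (c y w)%:R * (u (set_spin w y true) - u (set_spin w y false)) ^+ 2).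
  by rewrite mulr_ge0 ?mulr_ge0//; apply: expect_ge0 => w; rewrite mulr_ge0// sqr_ge0.
have [xS|xS] := boolP (x \in undup S).
  by rewrite (bigD1_seq x)//= ?undup_uniq// lerDl sumr_ge0.
rewrite (le_trans _ (sumr_ge0 _ (fun y _ => ge0 y)))//.
rewrite (_ : (fun w => _) = fun=> 0); first by rewrite expect_cst mulr0.
apply/funext => w; rewrite !(depends_on_set_spin _ _ uS) ?subrr ?expr0n ?mulr0//.
  by rewrite -mem_undup.
by rewrite -mem_undup.
Qed.

Lemma nnint_set_spin x f : measurable_fun setT f -> (forall w, 0 <= f w) ->
  (nnint mu f = p%:E * nnint mu (fun w => f (set_spin w x true)) +
             (1 - p)%:E * nnint mu (fun w => f (set_spin w x false)))%E.
Proof. exact: integral_set_spin. Qed.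

Lemma measurable_comp_set_spin f x b : measurable_fun setT f ->
  measurable_fun [set: config V] (fun w => f (set_spin w x b)).
Proof. by move=> mf; apply: measurableT_comp => //; exact: measurable_set_spin. Qed.

End DirichletForm.

(** * Functions in the kernel are invariant under legal flips *)

Section Kernel.
Context (R : realType) (V : countType) (k j : nat) (N : V -> seq V) (T : rooting k N).
Context (p : R).
Hypothesis p01 : 0 < p < 1.
Implicit Types (w : config V) (x y z : V) (f : config V -> R).

Local Notation E := (expect p).
Local Notation c x := (constraint N j x).
Local Notation L := (generator N j p).
Local Notation mu := (bernoulli_product V p).

Let p01' : 0 <= p <= 1. Proof. by case/andP: p01 => /ltW -> /ltW. Qed.
Let p0 : 0 < p. Proof. by case/andP: p01. Qed.
Let q0 : 0 < 1 - p. Proof. by rewrite subr_gt0; case/andP: p01. Qed.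

Lemma measurable_constraint x : measurable_fun [set: config V] (fun w => (c x w)%:R : R).
Proof. by apply: local_measurable; exact: local_constraint. Qed.

Lemma nnint_expect u : local_function u -> nnint mu u = (E u)%:E.
Proof. by move=> lu; rewrite expectE. Qed.

(** Let [v] be local, close to [f], with [L v] small. [dirichlet_le] bounds the gradient of [v] at
    [x], and invariance under resampling bounds that of [v - f]; both bounds vanish with [t]. *)
Lemma kernel_gradient x f : generator_L2 N j p f (0 \*: f) ->
  \forall w \ae mu, c x w -> f (set_spin w x true) = f (set_spin w x false).
Proof.
move=> [/Lfun2P[mf f2] _ [u [lu uf Luf]]].
have sq_local (v : config V -> R) : local_function v -> local_function (fun w => v w ^+ 2).
  exact: (local_comp (fun a => a ^+ 2)).
have sq_meas (v : config V -> R) : measurable_fun setT v -> measurable_fun setT (fun w => v w ^+ 2).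
  by move=> mv; apply: measurable_funX.
pose g (v : config V -> R) w := (c x w)%:R * (v (set_spin w x true) - v (set_spin w x false)) ^+ 2.
have mg v : measurable_fun setT v -> measurable_fun setT (g v).
  move=> mv; apply: measurable_funM; first exact: measurable_constraint.
  by apply: sq_meas; apply: measurable_funB; exact: measurable_comp_set_spin.
have g0 v w : 0 <= g v w by rewrite mulr_ge0// sqr_ge0.
pose a := fine (nnint mu (fun w => f w ^+ 2)).
have af : nnint mu (fun w => f w ^+ 2) = a%:E.
  by rewrite fineK// ge0_fin_numE// nnint_ge0// => w; exact: sqr_ge0.
have a0 : 0 <= a by rewrite -lee_fin -af nnint_ge0// => w; exact: sqr_ge0.
have pq0 : 0 <= p * (1 - p) by rewrite mulr_ge0 ?ltW.
have key t : 0 < t -> t <= 1 ->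
    (nnint mu (fun w => p * (1 - p) * g f w)%R <= (3 * (t * (a + 3)))%:E)%E.
  move=> t0 t1.
  have t20 : 0 < t ^+ 2 by rewrite exprn_gt0.
  have [n [un Ln]] : exists n,
      (nnint mu (fun w => (u n w - f w) ^+ 2)%R <= (t ^+ 2)%:E)%E /\
      (nnint mu (fun w => (L (u n) w - (0 \*: f) w) ^+ 2)%R <= (t ^+ 2)%:E)%E.
    exact: filter_ex (filterI (L2_cvg_nnint uf t20) (L2_cvg_nnint Luf t20)).
  have {}lu := lu n; move: (u n) lu un Ln => v lv vf Lv.
  have mv := local_measurable lv.
  have mvf : measurable_fun setT (fun w => (v w - f w) ^+ 2).
    by apply: sq_meas; apply: measurable_funB.
  have {Lv} ELv : E (fun w => L v w ^+ 2) <= t ^+ 2.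
    rewrite -lee_fin -nnint_expect; last by apply: sq_local; exact: local_generator.
    apply: le_trans Lv; rewrite le_eqVlt; apply/orP; left; apply/eqP.
    by apply: eq_integral => w _; rewrite /= scale0r subr0.
  have Ev : E (fun w => v w ^+ 2) <= 2 * a + 2 * t ^+ 2.
    rewrite -lee_fin -nnint_expect; last exact: sq_local.
    apply: (@le_trans _ _ (nnint mu (fun w => 2 * f w ^+ 2 + 2 * (v w - f w) ^+ 2))).
      apply: le_nnint.
      + exact: sq_meas.
      + by apply: measurable_funD; apply: measurable_funM => //; exact: sq_meas.
      + by move=> w; exact: sqr_ge0.
      + by move=> w; have := sqr_ge0 (v w - 2 * f w); rewrite !expr2; lra.
    rewrite nnintD; first last.
    + by move=> w; rewrite mulr_ge0// sqr_ge0.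
    + by move=> w; rewrite mulr_ge0// sqr_ge0.
    + by apply: measurable_funM => //.
    + by apply: measurable_funM => //; exact: sq_meas.
    rewrite !nnintZ//; [|by move=> w; exact: sqr_ge0|exact: sq_meas|by move=> w; exact: sqr_ge0].
    rewrite af; apply: (@le_trans _ _ (2%:E * a%:E + 2%:E * (t ^+ 2)%:E)%E).
      by rewrite leeD// lee_wpmul2l.
    by rewrite -!EFinM -EFinD.
  have D := dirichlet_le j T p01' x lv t0.
  have {}D : p * (1 - p) * E (g v) <= t * (a + 2).
    apply: (le_trans D).
    have : t / 2 * E (fun w => v w ^+ 2) <= t / 2 * (2 * a + 2 * t ^+ 2).
      by rewrite ler_wpM2l// divr_ge0// ltW.
    have : (2 * t)^-1 * E (fun w => L v w ^+ 2) <= (2 * t)^-1 * t ^+ 2.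
      by rewrite ler_wpM2l// invr_ge0 mulr_ge0// ltW.
    have -> : (2 * t)^-1 * t ^+ 2 = t / 2 by field; rewrite gt_eqF.
    have : t ^+ 3 <= t by rewrite -[leRHS]expr1 ler_wiXn2l// ltW.
    have -> : t / 2 * (2 * a + 2 * t ^+ 2) = t * a + t ^+ 3 by field.
    by lra.
  have lgv : local_function (g v).
    apply: localM; first exact: local_constraint.
    by apply: sq_local; apply: localB; exact: local_set_spin.
  pose h b w := (v (set_spin w x b) - f (set_spin w x b)) ^+ 2.
  have mh b : measurable_fun setT (h b).
    exact: (measurable_comp_set_spin x b mvf).
  have h0 b w : 0 <= h b w by exact: sqr_ge0.
  pose H w := p * h true w + (1 - p) * h false w.
  have mH : measurable_fun setT H.
    by apply: measurable_funD; apply: measurable_funM.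
  have H0 w : 0 <= H w.
    by apply: addr_ge0; apply: mulr_ge0; rewrite ?h0 ?(ltW p0) ?(ltW q0).
  (* [H] is the squared error averaged over the spin at [x], so resampling preserves its
     integral. *)
  have HE : nnint mu H = nnint mu (fun w => (v w - f w) ^+ 2).
    rewrite (nnint_set_spin p01' x mvf) => [|w]; last exact: sqr_ge0.
    rewrite nnintD; first last.
    - by move=> w; rewrite mulr_ge0// ltW.
    - by move=> w; rewrite mulr_ge0// ltW.
    - exact: measurable_funM.
    - exact: measurable_funM.
    by rewrite !nnintZ// ltW.
  apply: (@le_trans _ _ (nnint mu (fun w => 3 * (p * (1 - p)) * g v w + 3 * H w))).
    apply: le_nnint.
    - by apply: measurable_funM => //; exact: mg.
    - by apply: measurable_funD; apply: measurable_funM => //; exact: mg.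
    - by move=> w; rewrite mulr_ge0.
    - move=> w; rewrite /g /H /h.
      set A := v _; set B := v _; set F1 := f _; set F0 := f _.
      case: (c x w); last first.
        rewrite !mul0r !mulr0 add0r mulr_ge0// addr_ge0// mulr_ge0 ?sqr_ge0 ?ltW//.
      rewrite !mul1r.
      (* The gradient of [f] is that of [v] corrected by the two errors; afterwards [p * (1 - p)] is
         bounded by [p] and by [1 - p] to recover [H]. *)
      have e1 : (F1 - F0) ^+ 2 <= 3 * (A - B) ^+ 2 + 3 * (A - F1) ^+ 2 + 3 * (B - F0) ^+ 2.
        have := sqr_ge0 ((A - B) + (A - F1)); have := sqr_ge0 ((A - B) - (B - F0)).
        have := sqr_ge0 ((A - F1) + (B - F0)); rewrite !expr2; lra.
      have := ler_wpM2l pq0 e1.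
      have : 0 <= p * p * (A - F1) ^+ 2 := mulr_ge0 (mulr_ge0 (ltW p0) (ltW p0)) (sqr_ge0 _).
      have : 0 <= (1 - p) * (1 - p) * (B - F0) ^+ 2 :=
        mulr_ge0 (mulr_ge0 (ltW q0) (ltW q0)) (sqr_ge0 _).
      by lra.
  rewrite nnintD; first last.
  - by move=> w; rewrite mulr_ge0.
  - by move=> w; apply: mulr_ge0 => //; exact: mulr_ge0.
  - exact: measurable_funM.
  - by apply: measurable_funM => //; exact: mg.
  rewrite (@nnintZ _ _ _ mu _ _ (mg _ mv) (g0 v) (mulr_ge0 (ler0n _ 3) pq0)).
  rewrite (@nnintZ _ _ _ mu _ _ mH H0 (ler0n _ 3)).
  rewrite HE nnint_expect// -EFinM.
  apply: (@le_trans _ _ ((3 * (p * (1 - p)) * E (g v))%:E + 3%:E * (t ^+ 2)%:E)%E).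
    by rewrite leeD// lee_wpmul2l.
  rewrite -EFinM -EFinD lee_fin.
  have : t ^+ 2 <= t by rewrite -[leRHS]expr1 ler_wiXn2l// ltW.
  by lra.
have mpg : measurable_fun setT (fun w => p * (1 - p) * g f w).
  by apply: measurable_funM => //; exact: mg.
have : (nnint mu (fun w => p * (1 - p) * g f w)%R <= 0)%E.
  apply/lee_addgt0Pr => e e0; rewrite add0e.
  have a3 : 0 < 3 * (a + 3) by lra.
  (* Makes the bound of [key] at most [e] while keeping [t <= 1]. *)
  pose t := Num.min 1 (e / (3 * (a + 3))).
  have t0 : 0 < t by rewrite lt_min ltr01 divr_gt0.
  have t1 : t <= 1 by rewrite ge_min lexx.
  apply: (le_trans (key _ t0 t1)); rewrite lee_fin mulrCA -ler_pdivlMr//.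
  by rewrite ge_min lexx orbT.
move=> /(nnint_eq0_ae mpg) => /(_ (fun w => mulr_ge0 pq0 (g0 f w))).
apply: filterS => w /eqP; rewrite mulf_eq0 (gt_eqF (mulr_gt0 p0 q0))/= /g => /[swap].
move=> cw; rewrite cw mul1r sqrf_eq0 subr_eq0; exact: eqP.
Qed.

End Kernel.

(** * Subcritical densities *)

Section LegalInvariance.
Context (V : countType) (k j : nat) (N : V -> seq V) (T : rooting k N).
Context (A : Type) (f : config V -> A) (G : set (config V)).
Hypothesis G_set_spin : forall w x b, G w -> G (set_spin w x b).
Hypothesis f_legal : forall w x, G w -> constraint N j x w ->
  f (set_spin w x true) = f (set_spin w x false).
Implicit Types (w : config V) (x y z : V).

Local Notation clean := (clean j T).
Local Notation kids := (kids T).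

Lemma legal_set_spin w x b : G w -> constraint N j x w -> f (set_spin w x b) = f w.
Proof.
move=> Gw cw; have E := f_legal Gw cw; rewrite -[in RHS](set_spin_id w x).
by case: b; case: (w x); rewrite ?E.
Qed.

Let foldr_clean_legal n s w : (forall y w, G w -> G (clean n y w) /\ f (clean n y w) = f w) ->
  G w -> G (foldr (clean n) w s) /\ f (foldr (clean n) w s) = f w.
Proof.
move=> H Gw; elim: s => //= y s [Gs fs].
by have [? E] := H y _ Gs; split=> //; rewrite E.
Qed.

Let clean_legal n y w : G w -> G (clean n y w) /\ f (clean n y w) = f w.
Proof.
elim: n y w => [//|n IH] y w Gw /=.
have [Gs fs] := @foldr_clean_legal n (kids y) w IH Gw.
case: ifP => // cj; split; first exact: G_set_spin.
by rewrite legal_set_spin//; exact: constraint_kids cj.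
Qed.

(** Cleaning the kids of [x] consists of legal flips and commutes with setting the spin at [x], so
    both values of [f] can be compared after cleaning, where the flip at [x] is legal. [G], stable
    under spin changes, stands for the almost sure set. *)
Lemma legal_invariant n x w : (j <= size (kids x))%N -> G w ->
  {in kids x, forall z, ~~ blocked j T n z w} ->
  f (set_spin w x true) = f (set_spin w x false).
Proof.
move=> jx Gw ub.
have H b : f (set_spin w x b) = f (set_spin (foldr (clean n) w (kids x)) x b).
  rewrite -kids_foldr_clean_set_spin.
  by have [_ ->] := foldr_clean_legal (kids x) (clean_legal n) (G_set_spin x b Gw).
rewrite !H; apply: f_legal.
  by have [] := foldr_clean_legal (kids x) (clean_legal n) Gw.
apply: (@constraint_kids _ _ _ _ T); rewrite (leq_trans jx)// -size_filter.
rewrite (_ : [seq _ <- _ | _] = kids x)//; apply/all_filterP/allP => z zx /=.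
by rewrite (@foldr_clean_unblocked _ _ _ _ T n (kids x) w z)// ub.
Qed.

End LegalInvariance.

Lemma ae_forall_countable d (T : measurableType d) (R : realType)
    (mu : {measure set T -> \bar R}) (I : countType) (P : I -> T -> Prop) :
  (forall i, \forall w \ae mu, P i w) -> \forall w \ae mu, forall i, P i w.
Proof.
move=> aeP; pose Q n w := if pickle_inv n is Some i then P i w else True.
have : \forall w \ae mu, forall n : nat, Q n w.
  apply: ae_foralln => n; rewrite /Q; case: (pickle_inv n) => [i|]; first exact: aeP.
  exact: aeW.
by apply: filterS => w Qw i; have := Qw (pickle i); rewrite /Q pickleK_inv.
Qed.

(** * Almost sure unblocking, and invariance of kernel functions under every flip *)

Section Ergodicity.
Context (R : realType) (V : countType) (k j : nat) (N : V -> seq V) (T : rooting k N).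
Hypothesis jk : (j <= k)%N.
Context (p : R).
Hypothesis p01 : 0 < p < 1.
Hypothesis occupation0 : occupation k j p @ \oo --> 0.
Implicit Types (w : config V) (x y z : V) (f : config V -> R).

Local Notation E := (expect p).
Local Notation c x := (constraint N j x).
Local Notation mu := (bernoulli_product V p).

Let p01' : 0 <= p <= 1. Proof. by case/andP: p01 => /ltW -> /ltW. Qed.
Let p0 : 0 < p. Proof. by case/andP: p01. Qed.
Let q0 : 0 < 1 - p. Proof. by rewrite subr_gt0; case/andP: p01. Qed.

(** As [0 < p < 1], both spins have positive weight in the resampling identity, so the preimage of a
    null set is null. *)
Lemma ae_set_spin (P : config V -> Prop) x b : (\forall w \ae mu, P w) ->
  \forall w \ae mu, P (set_spin w x b).
Proof.
move=> [A [mA A0 PA]]; exists ((fun w => set_spin w x b : config V) @^-1` A).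
have mpre b' : measurable ((fun w => set_spin w x b' : config V) @^-1` A).
  by rewrite -[X in measurable X]setTI; exact: measurable_set_spin.
split=> //; last by move=> w /= Pw; exact: PA.
have /esym := bernoulli_product_set_spin p01' x mA; rewrite [X in _ = X]A0.
move=> /eqP; rewrite padde_eq0 ?mule_ge0 ?lee_fin ?(ltW p0) ?(ltW q0)//.
rewrite !mule_eq0 !eqe (gt_eqF p0) (gt_eqF q0)/= => /andP[/eqP h1 /eqP h0].
by case: b.
Qed.

(** Finite modifications are indexed by a countable type, so one null set can serve all of them. *)
Definition set_spins (l : seq (V * bool)) w : config V :=
  foldr (fun xb w => set_spin w xb.1 xb.2) w l.

Lemma ae_set_spins (P : config V -> Prop) : (\forall w \ae mu, P w) ->
  forall l, \forall w \ae mu, P (set_spins l w).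
Proof.
move=> aeP l; elim: l P aeP => // -[x b] l IH P aeP.
exact: (IH (fun w => P (set_spin w x b)) (ae_set_spin x b aeP)).
Qed.

(** The exceptional set lies in every event [B n], whose probabilities tend to zero. *)
Lemma ae_unblocked z : (0 < depth T z)%N -> \forall w \ae mu, exists n, ~~ blocked j T n z w.
Proof.
move=> dz; pose B n := [set w : config V | blocked j T n z w].
have mB n : measurable (B n).
  rewrite (_ : B n = blocked j T n z @^-1` [set true]); last by apply/seteqP; split.
  rewrite -[X in measurable X]setTI.
  exact: (depends_on_measurable (@blocked_depends _ _ j _ T n z)).
have muB n : mu (B n) = (occupation k j p n)%:E.
  rewrite -(@expect_blocked _ _ _ _ _ T p p01' n z dz) expectE//; last first.
    by apply: local_bool; exact: blocked_depends.
  rewrite -(setIT (B n)) -integral_indic//.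
  by apply: eq_integral => w _; rewrite indicE /B mem_setE.
exists (\bigcap_n B n); split.
- exact: bigcapT_measurable.
- apply/eqP; rewrite eq_le measure_ge0 andbT; apply/lee_addgt0Pr => e e0; rewrite add0e.
  have [n _ /(_ n (leqnn n))] := cvgr_le _ occupation0 _ e0.
  rewrite -lee_fin -muB; apply: le_trans.
  by apply: le_measure; rewrite ?inE//; [exact: bigcapT_measurable|exact: bigcap_inf].
- move=> w /= H n _; rewrite /B/=; apply/negPn/negP => nb; apply: H; by exists n.
Qed.

Lemma ae_all_unblocked x : \forall w \ae mu,
  exists n, {in kids T x, forall z, ~~ blocked j T n z w}.
Proof.
have : \forall w \ae mu, forall z, z \in kids T x -> exists n, ~~ blocked j T n z w.
  apply: ae_forall_countable => z; have [zx|zx] := boolP (z \in kids T x); last exact: aeW.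
  have : (0 < depth T z)%N by rewrite (depth_kids zx).
  by move=> /ae_unblocked; apply: filterS => w.
apply: filterS => w; elim: (kids T x) => [|y s IH] H; first by exists 0%N.
have [n Hn] := IH (fun z zs => H z (mem_behead (s := y :: s) zs)).
have [m Hm] := H y (mem_head _ _).
exists (maxn n m) => z; rewrite inE => /predU1P[->|/Hn].
  by apply: contra Hm; exact: blockedW (leq_maxr n m).
by apply: contra; exact: blockedW (leq_maxl n m).
Qed.

Lemma kernel_invariant f : generator_L2 N j p f (0 \*: f) ->
  \forall w \ae mu, forall x, f (set_spin w x true) = f (set_spin w x false).
Proof.
move=> kf.
pose leg w := forall x, c x w -> f (set_spin w x true) = f (set_spin w x false).
have aeleg : \forall w \ae mu, leg w.
  by apply: ae_forall_countable => x; exact: (@kernel_gradient _ _ _ _ _ T p p01 x f kf).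
(* Requiring [leg] after every finite modification makes the set stable under spin changes, as
   [legal_invariant] demands. *)
have aeG : \forall w \ae mu, forall l, leg (set_spins l w).
  by apply: ae_forall_countable => l; exact: ae_set_spins.
have aeU : \forall w \ae mu, forall x, exists n, {in kids T x, forall z, ~~ blocked j T n z w}.
  by apply: ae_forall_countable => x; exact: ae_all_unblocked.
apply: filterS2 aeG aeU => w Gw Uw x.
have [n Un] := Uw x.
apply: (@legal_invariant _ _ j _ T _ f [set w | forall l, leg (set_spins l w)] _ _ n) => //.
- move=> w' y b Gw' l; have := Gw' (rcons l (y, b)).
  by rewrite /set_spins foldr_rcons.
- by move=> w' y Gw'; exact: (Gw' [::]).
- by rewrite (leq_trans jk)// size_kids_ge.
Qed.

End Ergodicity.

(** * Invariant square integrable functions are constant *)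

Section InvariantConstant.
Context (R : realType) (V : countType) (p : R).
Hypothesis p01 : 0 < p < 1.
Implicit Types (w : config V) (x y z : V) (f u : config V -> R).

Local Notation mu := (bernoulli_product V p).

Let p01' : 0 <= p <= 1. Proof. by case/andP: p01 => /ltW -> /ltW. Qed.
Let p0 : 0 < p. Proof. by case/andP: p01. Qed.
Let q0 : 0 < 1 - p. Proof. by rewrite subr_gt0; case/andP: p01. Qed.

(* By convexity, averaging [u] over one spin does not increase its distance to
   the invariant function [f]. *)
Lemma invariant_local_distance f S u : measurable_fun [set: config V] f ->
  (\forall w \ae mu, forall x, f (set_spin w x true) = f (set_spin w x false)) ->
  depends_on S u -> exists m : R,
  (nnint mu (fun w => (f w - m) ^+ 2)%R <= nnint mu (fun w => (f w - u w) ^+ 2)%R)%E.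
Proof.
move=> mf finv; elim: S u => [|x S IH] u uS.
  exists (u (fun=> true)); rewrite le_eqVlt; apply/orP; left; apply/eqP.
  by apply: eq_integral => w _; rewrite (depends_on_nil uS w (fun=> true)).
pose v w := p * u (set_spin w x true) + (1 - p) * u (set_spin w x false).
have uS' b : depends_on S (fun w => u (set_spin w x b)) by exact: depends_on_set_spin_rem.
have vS : depends_on S v.
  by move=> w w' ww'; rewrite /v (uS' _ _ _ ww') (uS' _ _ _ ww').
have [m Hm] := IH v vS; exists m; apply: (le_trans Hm).
have mu_ b := depends_on_measurable (uS' b).
have mv := depends_on_measurable vS.
have mu0 := depends_on_measurable uS.
have msq (g : config V -> R) : measurable_fun setT g ->
    measurable_fun setT (fun w => (f w - g w) ^+ 2).
  by move=> mg; apply: measurable_funX; exact: measurable_funB.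
(* By invariance, resetting the spin at [x] matters only inside [u]. *)
have fb b : nnint mu (fun w => (f (set_spin w x b) - u (set_spin w x b)) ^+ 2) =
    nnint mu (fun w => (f w - u (set_spin w x b)) ^+ 2).
  apply: ge0_ae_eq_integral => //.
  - apply/measurable_EFinP; exact: (measurable_comp_set_spin x b (msq _ mu0)).
  - by apply/measurable_EFinP; exact: msq.
  - by move=> w _; rewrite lee_fin sqr_ge0.
  - by move=> w _; rewrite lee_fin sqr_ge0.
  - apply: filterS finv => w /(_ x) fw _; congr (((_ - _) ^+ 2)%:E).
    by rewrite -[in RHS](set_spin_id w x); case: b; case: (w x); rewrite ?fw.
rewrite [leRHS](nnint_set_spin p01' x (msq _ mu0)); last by move=> w; exact: sqr_ge0.
rewrite !fb -(@nnintZ _ _ _ mu _ _ (msq _ (mu_ true)) (fun w => sqr_ge0 _) (ltW p0)).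
rewrite -(@nnintZ _ _ _ mu _ _ (msq _ (mu_ false)) (fun w => sqr_ge0 _) (ltW q0)).
rewrite -nnintD; first last.
- by move=> w; rewrite mulr_ge0 ?sqr_ge0// ltW.
- by move=> w; rewrite mulr_ge0 ?sqr_ge0// ltW.
- by apply: measurable_funM => //; exact: msq.
- by apply: measurable_funM => //; exact: msq.
apply: le_nnint.
- exact: msq.
- by apply: measurable_funD; apply: measurable_funM => //; exact: msq.
- by move=> w; exact: sqr_ge0.
- move=> w; rewrite /v; set a := u _; set b := u _.
  have : 0 <= p * (1 - p) * (a - b) ^+ 2 := mulr_ge0 (mulr_ge0 (ltW p0) (ltW q0)) (sqr_ge0 _).
  (* The gap in the convexity inequality is the variance of [u] over the spin at [x]. *)
  move=> h; rewrite -subr_ge0 (_ : _ - _ = p * (1 - p) * (a - b) ^+ 2)//; ring.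
Qed.

(** The squared distance from [f] to a constant is least at the mean [b], where it is the variance;
    arbitrarily small distances make the variance zero. *)
Lemma approx_constant f : f \in Lfun mu 2%:E ->
  (forall e, 0 < e -> exists m : R, (nnint mu (fun w => (f w - m) ^+ 2)%R <= e%:E)%E) ->
  exists c : R, f = cst c %[ae mu].
Proof.
move=> lf H; have [mf _] := (Lfun2P _ _).1 lf.
have if2 := Lfun2_integrable_sqr lf.
have if1 : mu.-integrable setT (EFin \o f).
  have /Lfun1_integrable := @Lfun2_mul_Lfun1 _ _ _ mu f (cst 1) lf (Lfun_cst _ _ _).
  by rewrite (_ : f \* cst 1 = f)//; apply/funext => w /=; rewrite mulr1.
pose a := Rintegral mu setT (fun w => f w ^+ 2); pose b := Rintegral mu setT f.
have E m : nnint mu (fun w => (f w - m) ^+ 2) = (a - 2 * m * b + m ^+ 2)%:E.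
  have i1 : mu.-integrable setT (EFin \o (fun w => 2 * m * f w)).
    by have := integrableZl measurableT (2 * m) if1.
  have i2 : mu.-integrable setT (EFin \o (fun w => f w ^+ 2 - 2 * m * f w)).
    by have := integrableB measurableT if2 i1.
  have i3 : mu.-integrable setT (EFin \o cst (m ^+ 2)).
    exact: finite_measure_integrable_cst.
  rewrite /nnint; under eq_integral => w _.
    rewrite (_ : (f w - m) ^+ 2 = (f w ^+ 2 - 2 * m * f w) + cst (m ^+ 2) w); last
      by rewrite /=; ring.
    over.
  have fi : (\int[mu]_w ((f w ^+ 2 - 2 * m * f w) + cst (m ^+ 2) w)%:E)%E \is a fin_num.
    by apply: integrable_fin_num => //; exact: (integrableD measurableT i2 i3).
  rewrite -(fineK fi); congr EFin.
  rewrite -/(Rintegral mu setT (fun w => (f w ^+ 2 - 2 * m * f w) + cst (m ^+ 2) w)).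
  rewrite RintegralD// RintegralB// RintegralZl//; congr (_ + _).
  exact: expect_cst.
have var0 : a - b ^+ 2 <= 0.
  apply/ler_addgt0Pr => e e0; rewrite add0r.
  have [m] := H e e0; rewrite E lee_fin; have := sqr_ge0 (m - b); rewrite !expr2; lra.
exists b.
have mfb : measurable_fun [set: config V] (fun w => (f w - b) ^+ 2).
  by apply: measurable_funX; exact: measurable_funB.
have : (nnint mu (fun w => (f w - b) ^+ 2)%R <= 0)%E.
  by rewrite E lee_fin; move: var0; rewrite !expr2; lra.
move=> /(nnint_eq0_ae mfb) => /(_ (fun w => sqr_ge0 _)).
by apply: filterS => w /eqP; rewrite sqrf_eq0 subr_eq0 => /eqP.
Qed.

End InvariantConstant.

Section SimpleEigenvalue.
Context (R : realType) (V : countType) (k j : nat) (N : V -> seq V) (T : rooting k N).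
Context (p : R).
Local Notation mu := (bernoulli_product V p).

Lemma not_ae_false (P : config V -> Prop) : (forall w, ~ P w) -> ~ \forall w \ae mu, P w.
Proof.
move=> nP [A [mA A0 PA]].
have : (mu setT <= mu A)%E by apply: le_measure; rewrite ?inE// => w _; apply: PA => /nP.
rewrite [X in (_ <= X)%E]A0 (_ : mu setT = 1%E); first by rewrite lee_fin ler10.
exact: probability_setT.
Qed.

Lemma generator_cst (c : R) : generator N j p (cst c) = cst 0.
Proof. by apply/funext => w; rewrite (@generatorE _ _ _ _ _ [::])//= big_nil. Qed.

Lemma L2_closure_cst (c : R) : generator_L2 N j p (cst c) (0 \*: cst c).
Proof.
have z : (0 \*: (cst c : config V -> R)) = cst 0 by apply/funext => w /=; rewrite scale0r.
rewrite z; split; [exact: Lfun_cst|exact: Lfun_cst|].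
exists (fun=> cst c); split => [_||].
- by exists [::].
- apply: (@nnint_L2_cvg _ _ _ _ _ _ (fun=> 0)); last exact: cvg_cst.
  move=> n; rewrite [leLHS](_ : _ = 0%E)//.
  by apply: integral0_eq => w _; rewrite /= subrr expr0n.
- apply: (@nnint_L2_cvg _ _ _ _ _ _ (fun=> 0)); last exact: cvg_cst.
  move=> n; rewrite [leLHS](_ : _ = 0%E)//.
  by apply: integral0_eq => w _; rewrite generator_cst/= subrr expr0n.
Qed.

(** Constants always lie in the kernel, so a one-dimensional kernel consists of constants only. *)
Lemma zero_simple_eigenvalueP : zero_simple_eigenvalue N j p <->
  forall f, generator_L2 N j p f (0 \*: f) -> exists c : R, f = cst c %[ae mu].
Proof.
split=> [[e [_ _ eP]] f|H].
  have [c0 c0E] := eP _ (L2_closure_cst 1).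
  move=> /eP[c fE]; exists (c / c0).
  apply: filterS2 c0E fE => w /= h1 h2 /=.
  have c00 : c0 != 0.
    by apply/eqP => c00; have := h1 I; rewrite c00 scale0r => /eqP; rewrite oner_eq0.
  move=> _; rewrite h2//; have := h1 I; rewrite /GRing.scale/= => E.
  by apply: (mulIf c00); rewrite mulfVK// /GRing.scale/= -mulrA [_ * c0]mulrC -E mulr1.
exists (cst 1); split; first exact: L2_closure_cst.
- move=> h; have F : \forall w \ae mu, False.
    by apply: filterS h => w /(_ I) /eqP; rewrite /= oner_eq0.
  exact: (@not_ae_false (fun=> False) (fun _ => id) F).
- move=> f /H[c fc]; exists c; apply: filterS fc => w fw /fw ->.
  by rewrite /= /GRing.scale/= mulr1.
Qed.

(** At [p = 0] almost every configuration is the empty one, so every function is constant almost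
    everywhere. The resampling argument starts at [p > 0]. *)
Lemma zero_density_simple : p = 0 -> zero_simple_eigenvalue N j p.
Proof.
move=> pE; apply/zero_simple_eigenvalueP => f _; exists (f (fun=> false)).
have p01 : 0 <= p <= 1 by rewrite pE lexx ler01.
have : \forall w \ae mu, forall x, w x = false.
  apply: ae_forall_countable => x; exists [set w : config V | w x]; split.
  - exact: measurable_occupied.
  - have := bernoulli_productP p01 (s := [:: x]) (fun=> true) isT.
    rewrite big_seq1 /= [X in _ = X%:E]pE => Ex; apply: (etrans _ Ex).
    congr (mu _); apply/seteqP; split => w /=.
      by move=> wx y; rewrite inE => /eqP ->.
    by move=> /(_ x); rewrite mem_head => ->.
  - by move=> w /=; case: (w x) => // nf; case: nf.
move=> H; apply: (@filterS _ _ (ae_filter_ringOfSetsType mu) _ _ _ H) => w w0 _ /=.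
by congr f; apply/funext => x; exact: w0.
Qed.

Lemma subcritical_simple : (0 < j)%N -> (j <= k)%N -> 0 <= p <= 1 -> p < ptilde R k j ->
  zero_simple_eigenvalue N j p.
Proof.
move=> j0 jk /andP[]; rewrite le_eqVlt => /predU1P[/esym pE _ _|p0 p1 pt].
  exact: zero_density_simple.
have p01 : 0 < p < 1 by rewrite p0 (lt_le_trans pt)// ptilde_le1.
have occ : occupation k j p @ \oo --> 0.
  by apply: occupation_subcritical => //; rewrite ltW.
apply/zero_simple_eigenvalueP => f kf.
have finv := kernel_invariant T jk p01 occ kf.
have [lf _ [u [lu uf _]]] := kf; have [mf _] := (Lfun2P _ _).1 lf.
apply: approx_constant => // e e0.
have [n /= un] := filter_ex (L2_cvg_nnint uf e0).
have [S uS] := lu n.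
have [m fm] := invariant_local_distance p01 mf finv uS.
exists m; apply: (le_trans fm); apply: le_trans un; rewrite le_eqVlt; apply/orP; left.
by apply/eqP; apply: eq_integral => w _; rewrite -sqrrN opprB.
Qed.

End SimpleEigenvalue.

(** * Supercritical densities *)

(** Cauchy-Schwarz against the constant [1], summing [2 * a * b <= a ^ 2 + b ^ 2] over all pairs. *)
Lemma sqr_sum_le_size (R : realType) (I : eqType) (s : seq I) (a : I -> R) :
  (\sum_(i <- s) a i) ^+ 2 <= (size s)%:R * \sum_(i <- s) a i ^+ 2.
Proof.
have -> : (size s)%:R * \sum_(i <- s) a i ^+ 2 =
    \sum_(i <- s) \sum_(i' <- s) (a i ^+ 2 + a i' ^+ 2) / 2.
  under [RHS]eq_bigr => i _ do
    rewrite -mulr_suml big_split/= big_const_seq count_predT iter_addr_0.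
  rewrite -mulr_suml big_split/= big_const_seq count_predT iter_addr_0 sumrMnl.
  by rewrite -[_ *+ _]mulr_natl; field.
rewrite expr2 big_distrlr/=; apply: ler_sum => i _; apply: ler_sum => i' _.
by have := sqr_ge0 (a i - a i'); rewrite ler_pdivlMr// !expr2; lra.
Qed.

(** Asking uniqueness of [s] alone avoids proving that a [level] has no repetitions. *)
Lemma ler_sum_mem (R : realType) (I : eqType) (s l : seq I) (h : I -> R) :
  (forall i, 0 <= h i) -> uniq s ->
  \sum_(i <- s) (i \in l)%:R * h i <= \sum_(i <- l) h i.
Proof.
move=> h0; elim: s l => [|x s IH] l /=; first by rewrite big_nil sumr_ge0.
move=> /andP[xs us]; rewrite big_cons; have [xl|xl] := boolP (x \in l); last first.
  by rewrite mul0r add0r IH.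
rewrite mul1r (perm_big _ (perm_to_rem xl)) big_cons lerD2l (le_trans _ (IH _ us))//.
rewrite big_seq [leRHS]big_seq; apply: ler_sum => i si.
rewrite ler_wpM2r// ler_nat; have [il|//] := boolP (i \in l).
by rewrite (perm_mem (perm_to_rem xl)) inE in il; case/predU1P: il xs => [<-|->//]; rewrite si.
Qed.

Section Supercritical.
Context (R : realType) (V : countType) (k j : nat) (N : V -> seq V) (T : rooting k N).
Hypotheses (j_gt0 : (0 < j)%N) (jk : (j <= k)%N).
Context (p : R).
Hypotheses (p_ge0 : 0 <= p) (p_lt1 : p < 1) (p_gt : ptilde R k j < p).
Implicit Types (w : config V) (x y z : V).

Local Notation E := (expect p).
Local Notation c x := (constraint N j x).
Local Notation L := (generator N j p).
Local Notation mu := (bernoulli_product V p).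
Local Notation kids := (kids T).
Local Notation blocked := (blocked j T).
Local Notation root := (tree_root T).

Let p01 : 0 <= p <= 1. Proof. by rewrite p_ge0 ltW. Qed.

(* Requiring all the kids of the root to be blocked, rather than enough of them,
   makes the number of kids of the root irrelevant. *)
Definition root_blocked n w : bool :=
  w root && (count (fun y => ~~ blocked n y w) (kids root) < 1)%N.

Let frozen : set (config V) := \bigcap_n [set w | root_blocked n w].

Let support n := root :: flatten [seq zone T n y | y <- kids root].

Lemma root_blocked_depends n : depends_on (support n) (root_blocked n).
Proof.
move=> w w' ww'; rewrite /root_blocked ww' ?mem_head//; congr (_ && (_ < _)%N).
by apply: unblocked_depends => x xs; apply: ww'; rewrite inE xs orbT.
Qed.

Let u n w : R := (root_blocked n w)%:R.

Let local_u n : local_function (u n).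
Proof. by apply: local_bool; exact: root_blocked_depends. Qed.

Let root_blockedS n w : root_blocked n.+1 w -> root_blocked n w.
Proof.
move=> /andP[wr cn]; rewrite /root_blocked wr (leq_ltn_trans _ cn)//.
by apply: sub_count => z /=; apply: contra; exact: blockedS.
Qed.

Let measurable_root_blocked n : measurable [set w : config V | root_blocked n w].
Proof.
rewrite (_ : [set w | _] = root_blocked n @^-1` [set true]); last by apply/seteqP; split.
by rewrite -[X in measurable X]setTI; exact: (depends_on_measurable (@root_blocked_depends n)).
Qed.

Let measurable_frozen : measurable frozen.
Proof. exact: bigcapT_measurable. Qed.

Let mu_root_blocked n : mu [set w | root_blocked n w] = (E (u n))%:E.
Proof.
rewrite expectE// -(setIT [set w | root_blocked n w]) -integral_indic//.
by apply: eq_integral => w _; rewrite indicE mem_setE.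
Qed.

Let frozen_cvg : (E (u n))%:E @[n --> \oo] --> mu frozen.
Proof.
under eq_fun do rewrite -mu_root_blocked.
apply: nonincreasing_cvg_mu => //.
- by rewrite (le_lt_trans (probability_le1 _ _)) ?ltry.
- apply/nonincreasing_seqP => n; apply/subsetPset => w; exact: root_blockedS.
Qed.

Let occupation_gt0 : exists2 l : R, 0 < l & forall n, l <= occupation k j p n.
Proof.
have [l [/andP[l0 l1] ol _]] := dbinomial_tail_supercritical j_gt0 jk p_gt p_lt1 p_ge0.
exists l => // n; rewrite -(cvg_lim _ ol)//; apply: nonincreasing_cvgn_ge.
  exact: occupation_nonincreasing.
by apply/cvg_ex; exists l.
Qed.

Let expect_u n : E (u n) = p * occupation k j p n ^+ size (kids root).
Proof.
rewrite (_ : u n = fun w => (w root)%:R *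
  (count (fun y => ~~ blocked n y w) (kids root) < 1)%N%:R); last first.
  by apply/funext => w; rewrite /u -natrM mulnb.
rewrite (@expectM _ _ _ p01 [:: root] (flatten [seq zone T n y | y <- kids root])).
- rewrite expect_occupied// (@expect_unblocked _ _ _ _ _ T p p01 n _ 1 (depth T root)).
  + by rewrite /binomial_tail big_ord1 bin0 subn0 mul1r expr0 mulr1.
  + exact: kids_uniq.
  + by move=> z /depth_kids.
- exact: coord_depends.
- by apply: (@depends_on_comp _ _ _ _ (fun m => (m < 1)%N%:R)); exact: unblocked_depends.
- move=> x; rewrite inE => /eqP ->; apply/negP => /flatten_mapP[z zr].
  by apply/negP; exact: zone_kid.
Qed.

(** The probabilities of the decreasing events [root_blocked n] stay above a positive constant,
    since the occupation does. *)
Let mu_frozen_gt0 : (0 < mu frozen)%E.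
Proof.
have [l l0 lo] := occupation_gt0.
have pt0 := ptilde_gt0 R j_gt0 jk.
apply: (@lt_le_trans _ _ (p * l ^+ size (kids root))%:E).
  by rewrite lte_fin mulr_gt0 ?exprn_gt0// (lt_trans pt0).
rewrite -(cvg_lim _ frozen_cvg)//; apply: lime_ge.
  by apply/cvg_ex; exists (mu frozen); exact: frozen_cvg.
apply: nearW => n; rewrite lee_fin expect_u ler_wpM2l// lerXn2r// nnegrE ?(ltW l0)//.
by rewrite (le_trans (ltW l0)).
Qed.

Let f : config V -> R := \1_frozen.

(** Both functions are indicators and [f <= u n], so their difference is its own square. *)
Let u_distance n : nnint mu (fun w => (u n w - f w) ^+ 2) = (E (u n) - fine (mu frozen))%:E.
Proof.
have mf : measurable_fun setT f by exact: measurable_indic.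
have fin : mu frozen \is a fin_num by exact: fin_num_measure.
have fu w : f w <= u n w.
  rewrite /f /u indicE; have [|] := boolP (w \in frozen) => //.
  by rewrite inE => /(_ n I) /= ->.
have sq w : (u n w - f w) ^+ 2 = u n w - f w.
  move: (fu w); rewrite /f /u indicE; case: (root_blocked n w); case: (_ \in _);
    by rewrite /= ?ler10// => _; ring.
have mu_ := local_measurable (local_u n).
have D : (nnint mu (u n) = nnint mu (fun w => u n w - f w)%R + nnint mu f)%E.
  rewrite -nnintD//.
  - by congr nnint; apply/funext => w; rewrite subrK.
  - exact: measurable_funB.
  - by move=> w; rewrite subr_ge0.
have fE : nnint mu f = mu frozen by rewrite /nnint integral_indic// setIT.
rewrite (_ : (fun w => _) = fun w => u n w - f w); last by apply/funext => w; exact: sq.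
have nE : nnint mu (u n) = (E (u n))%:E by rewrite /nnint expectE.
move: D; rewrite fE nE -{1}(fineK fin); move: (nnint _ _) => [r| |] //.
by rewrite -EFinD => -[->]; rewrite addrK.
Qed.

Let u_cvg : L2_cvg mu u f.
Proof.
apply: (nnint_L2_cvg (s := fun n => E (u n) - fine (mu frozen))).
  by move=> n; rewrite u_distance.
rewrite -[X in _ --> X](subrr (fine (mu frozen))); apply: cvgB; last exact: cvg_cst.
have fin : mu frozen \is a fin_num by exact: fin_num_measure.
have := frozen_cvg; rewrite -(fineK fin) => /fine_cvgP[_].
by [].
Qed.

(** The root has no parent: a legal flip there requires an empty kid, and [root_blocked] then fails
    under both spins. Elsewhere [blocked_legal] leaves only the sites of the last generation
    read. *)
Let pivotal_site n x w : c x w ->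
  root_blocked n.+1 (set_spin w x true) != root_blocked n.+1 (set_spin w x false) ->
  exists2 y, y \in kids root & (x \in level T n y) &&
    (blocked n.+1 y (set_spin w x true) != blocked n.+1 y (set_spin w x false)).
Proof.
move=> cx; have no_parent z : root \notin kids z.
  by apply/negP => /depth_kids; rewrite depth_tree_root.
have [xr|xr] := eqVneq x root.
  subst x; have := @kids_constraint _ _ j _ T root w _ cx.
  move=> /(_ (fun y ry => False_ind _ (negP (no_parent y) ry))) jc.
  have H b : root_blocked n.+1 (set_spin w root b) = false.
    apply/negbTE; rewrite negb_and; apply/orP; right; rewrite -leqNgt -has_count.
    have : has (fun y => ~~ w y) (kids root) by rewrite has_count (leq_trans j_gt0).
    move=> /hasP[y yr wy]; apply/hasP; exists y => //=.
    rewrite set_spin_neq ?(negbTE wy)//.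
    by apply: contraTneq yr => ->; exact: no_parent.
  by rewrite !H.
rewrite /root_blocked !set_spin_neq ?[root == x]eq_sym//; case: (boolP (w root)) => //= wr.
move=> dif.
have : has (fun y => blocked n.+1 y (set_spin w x true) != blocked n.+1 y (set_spin w x false))
    (kids root).
  apply: contraT; rewrite -all_predC => /allP al; move: dif.
  rewrite (_ : count _ _ = count (fun y => ~~ blocked n.+1 y (set_spin w x false)) (kids root))
    ?eqxx//.
  by apply: eq_in_count => y /al /=; rewrite negbK => /eqP ->.
move=> /hasP[y yr bd]; exists y => //; rewrite bd andbT.
apply: contraT => xl; move: bd.
have par z : y \in kids z -> w z by move=> /parent_kids <-; rewrite (parent_kids yr).
by rewrite !(blocked_legal _ cx par xl) eqxx.
Qed.

(** Each term is at most [1] in absolute value, and nonzero only at legal pivotal sites; exchanging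
    the sums leads to [sum_level_pivotal]. *)
Let generator_bound n w :
  `|L (u n.+1) w| <= \sum_(y <- kids root) pivotal R j T n y w.
Proof.
rewrite (@generatorE _ _ _ _ _ (support n.+1)); last first.
  by apply: (@depends_on_comp _ _ _ _ (fun b : bool => b%:R)); exact: root_blocked_depends.
apply: (le_trans (ler_norm_sum _ _ _)).
pose d x y : R := (blocked n.+1 y (set_spin w x true) != blocked n.+1 y (set_spin w x false))%:R.
apply: (@le_trans _ _ (\sum_(x <- undup (support n.+1)) \sum_(y <- kids root)
    (x \in level T n y)%:R * d x y)).
  apply: ler_sum => x _.
  have dge0 : 0 <= \sum_(y <- kids root) (x \in level T n y)%:R * d x y.
    by apply: sumr_ge0 => y _; rewrite mulr_ge0.
  case: (boolP (c x w)) => cx; last by rewrite mul0r normr0.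
  rewrite mul1r.
  have [same|] := eqVneq (root_blocked n.+1 (set_spin w x true))
                         (root_blocked n.+1 (set_spin w x false)).
    have uE b : u n.+1 (set_spin w x b) = u n.+1 w.
      by rewrite /u -{2}(set_spin_id w x); case: b; case: (w x); rewrite ?same.
    by rewrite /site_average !uE (_ : _ - _ = 0) ?normr0//; ring.
  move=> /(pivotal_site cx)[y yr /andP[xy bd]].
  apply: (@le_trans _ _ 1).
    rewrite /site_average /u.
    case: (root_blocked _ _); case: (root_blocked _ _); case: (root_blocked _ _);
    by rewrite /= ler_norml; apply/andP; split; have := p_ge0; have := p_lt1; lra.
  rewrite (bigD1_seq y)//= ?kids_uniq// /d xy bd mulr1 lerDl.
  by apply: sumr_ge0 => y' _; rewrite mulr_ge0.
rewrite exchange_big/=; apply: ler_sum => y _.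
apply: le_trans (sum_level_pivotal R T j_gt0 n y w).
apply: (@ler_sum_mem _ _ _ _ (fun x => d x y)) => [x|].
  exact: ler0n.
exact: (undup_uniq (support n.+1)).
Qed.

Let K : R := (size (kids root))%:R.

Let expect_generator n : E (fun w => L (u n.+1) w ^+ 2) <=
  K ^+ 2 * pivotal_second_moment k j p n.
Proof.
have lp y : local_function (fun w => pivotal R j T n y w ^+ 2).
  by apply: (local_comp (fun a => a ^+ 2)); exact: local_pivotal.
have lsum : local_function (fun w => \sum_(y <- kids root) pivotal R j T n y w ^+ 2).
  exact: local_sum.
apply: (@le_trans _ _ (E (fun w => K * \sum_(y <- kids root) pivotal R j T n y w ^+ 2))).
  apply: expect_le.
  - by apply: (local_comp (fun a => a ^+ 2)); exact: local_generator.
  - by apply: localM => //; exact: local_cst.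
  - move=> w; rewrite -real_normK ?num_real//.
    apply: le_trans (sqr_sum_le_size _ _); apply: lerXn2r; rewrite ?nnegrE//.
    by apply: sumr_ge0 => y _; exact: pivotal_ge0.
rewrite expectZ// expect_sum// expr2 -mulrA ler_wpM2l//.
rewrite /K mulr_natl -iter_addr_0 -(count_predT (kids root)) -big_const_seq.
rewrite big_seq [leRHS]big_seq; apply: ler_sum => y yr.
by apply: expect_pivotal_sqr => //; rewrite (depth_kids yr).
Qed.

(** The indicator of [frozen] is in the kernel, as the limit of the local [u n.+1] whose generators
    tend to zero. It is not constant: [frozen] has positive probability and is incompatible with an
    empty root. *)
Lemma supercritical_not_simple : ~ zero_simple_eigenvalue N j p.
Proof.
have mf : measurable_fun setT f by exact: measurable_indic.
have Lf : f \in Lfun mu 2%:E.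
  apply/Lfun2P; split=> //; apply: (@le_lt_trans _ _ (nnint mu (cst 1))).
    apply: le_nnint => //.
    - exact: measurable_funX.
    - by move=> w; exact: sqr_ge0.
    - by move=> w; rewrite /f indicE; case: (_ \in _); rewrite /= ?expr1n ?expr0n.
  by rewrite nnint_expect ?expect_cst ?ltry//; exact: local_cst.
move=> /zero_simple_eigenvalueP /(_ f)[].
  have z : 0 \*: f = cst 0 by apply/funext => w /=; rewrite scale0r.
  rewrite z; split=> //; first exact: Lfun_cst.
  exists (fun n => u n.+1); split=> [n||].
  - exact: local_u.
  - by rewrite /L2_cvg (cvg_shiftS (fun n => ('N[mu]_2%:E[EFin \o (u n \- f)%R])%E)); exact: u_cvg.
  - apply: (nnint_L2_cvg (s := fun n => K ^+ 2 * pivotal_second_moment k j p n)).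
      move=> n; rewrite (_ : nnint _ _ = (E (fun w => L (u n.+1) w ^+ 2))%:E).
        by rewrite lee_fin expect_generator.
      rewrite expectE; last first.
        by apply: (local_comp (fun a => a ^+ 2)); exact: local_generator.
      by apply: eq_integral => w _; rewrite /= subr0.
    have [l [_ ol dl]] := dbinomial_tail_supercritical j_gt0 jk p_gt p_lt1 p_ge0.
    rewrite -[X in _ --> X](mulr0 (K ^+ 2)); apply: cvgMr.
    exact: pivotal_second_moment_cvg0 p01 ol dl.
move=> a fa.
have nul (A : set (config V)) (v : R) : measurable A -> (forall w, A w -> f w = v) ->
    a != v -> mu A = 0%E.
  move=> mA Av av; apply: (measure_negligible mA).
  apply: negligibleS fa => w Aw /= /(_ I) fw.
  by move: av; rewrite -(Av _ Aw) fw/= eqxx.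
(* Positivity of [mu frozen] forces the constant to be [1]; the event [Z] of an empty root, of
   probability [1 - p > 0], then refutes it. *)
have [a1|a1] := eqVneq a 1; last first.
  have := mu_frozen_gt0; rewrite (nul _ 1 measurable_frozen) ?ltxx//.
  by move=> w fw; rewrite /f indicE mem_set.
pose Z := [set w : config V | {in [:: root], w =1 fun=> false}].
have ZE : Z = (fun w : config V => w root) @^-1` [set false].
  apply/seteqP; split => w /= h; first by apply: h; rewrite mem_head.
  by move=> x; rewrite inE => /eqP ->.
have mZ : measurable Z.
  by rewrite ZE -[X in measurable X]setTI; exact: measurable_coord.
have Z0 w : Z w -> f w = 0.
  rewrite ZE /= => wr; rewrite /f indicE memNset// => /(_ 0%N I) /=.
  by rewrite /root_blocked wr.
have := nul Z 0 mZ Z0; rewrite a1 oner_eq0 => /(_ isT).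
rewrite /Z (bernoulli_productP p01 (s := [:: root]) (fun=> false) isT) big_seq1/= => -[].
by apply/eqP; rewrite subr_eq0 gt_eqF.
Qed.

End Supercritical.

(** * The two trees *)

Lemma critical_densityE (R : realType) (V : countType) (k j : nat) (N : V -> seq V)
  (T : rooting k N) : (0 < j)%N -> (j <= k)%N -> critical_density R N j = ptilde R k j.
Proof.
move=> j0 jk; rewrite /critical_density; set S := [set p : R | _].
have pt0 := ptilde_gt0 R j0 jk; have pt1 := ptilde_le1 R jk.
have S0 : S 0.
  split; first by rewrite lexx ltr01.
  by apply: (subcritical_simple T) => //; rewrite lexx ler01.
have Sub : ubound S (ptilde R k j).
  move=> p [/andP[p0 p1] simple]; rewrite leNgt; apply/negP => pt.
  exact: (supercritical_not_simple T j0 jk p0 p1 pt).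
apply/eqP; rewrite eq_le ge_sup//=; last by exists 0.
rewrite leNgt; apply/negP => lt.
have s0 : 0 <= sup S by apply: ub_le_sup S0; exists (ptilde R k j).
(* If the supremum were below the threshold, this midpoint would be a subcritical density in [S]
   exceeding [sup S]. *)
pose p := (sup S + ptilde R k j) / 2.
have : S p.
  split; first by rewrite /p; lra.
  by apply: (subcritical_simple T) => //; rewrite /p; lra.
have hS : has_ubound S by exists (ptilde R k j).
by move=> /(ub_le_sup hS); rewrite /p; lra.
Qed.

(** * The rooting of the rooted tree *)

Section RootedTree.
Context (k : nat).

Let child_depth (x y : rooted_tree k) : y \in children x -> size y = (size x).+1.
Proof. by move=> /mapP[i _ ->]. Qed.

Let child_parent (x y : rooted_tree k) : y \in children x -> behead y = x.
Proof. by move=> /mapP[i _ ->]. Qed.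

Let children_uniq (x : rooted_tree k) : uniq (children x).
Proof. by rewrite map_inj_uniq ?enum_uniq// => i i' []. Qed.

Let size_children (x : rooted_tree k) : size (children x) = k.
Proof. by rewrite size_map size_enum_ord. Qed.

Definition rooted_tree_rooting : rooting k (@children k) :=
  @Rooting _ k (@children k) [::] behead size (@children k) erefl child_depth child_parent
    children_uniq (fun x _ => size_children x) (fun x => eq_leq (esym (size_children x)))
    children_uniq (fun x y => id) (fun x y => @or_introl _ _).

End RootedTree.

(** * The rooting of the regular tree at the empty word *)

Section RegularTree.
Context (k : nat).
Implicit Types x y : regular_tree k.

Lemma reduced_behead (s : seq 'I_k.+1) : reduced s -> reduced (behead s).
Proof. by case: s => [|a s] //=; exact: path_sorted. Qed.

Let parent x : regular_tree k := exist _ (behead (val x)) (reduced_behead (valP x)).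

Let kids x := [seq y <- neighbors x | size (val y) == (size (val x)).+1].

(** The word grows unless [a] cancels the first letter of [x], so the single shorter neighbor of a
    nonempty word is its parent. *)
Lemma size_neighbor x a : (size (val (neighbor x a)) == (size (val x)).+1) =
  (ohead (val x) != Some a).
Proof.
case: x => -[|c t] //= rs; rewrite (inj_eq Some_inj) [c == a]eq_sym.
case: (eqVneq a c) => _ /=; last by rewrite eqxx.
by rewrite -addn2 -[X in X == _]addn0 eqn_add2l.
Qed.

Let kid_parent x y : y \in kids x -> parent y = x.
Proof.
rewrite mem_filter => /andP[+ /mapP[a _ yE]]; rewrite {y}yE size_neighbor => xa.
apply: val_inj => /=; case: x xa => -[|c t] //= rs; rewrite (inj_eq Some_inj) [c == a]eq_sym.
by move=> /negbTE ->.
Qed.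

Let size_kids x : (0 < size (val x))%N -> size (kids x) = k.
Proof.
move=> x0; rewrite /kids size_filter count_map.
have [c cE] : exists c, ohead (val x) = Some c by case: x x0 => -[|c t] //= rs _; exists c.
rewrite (@eq_count _ _ (predC (pred1 c))) => [|a]; last first.
  by rewrite /= size_neighbor cE (inj_eq Some_inj) eq_sym.
have := count_predC (pred1 c) (enum 'I_k.+1).
rewrite count_uniq_mem ?enum_uniq// mem_enum size_enum_ord add1n => -[].
by [].
Qed.

Let size_kids_ge x : (k <= size (kids x))%N.
Proof.
have [|] := posnP (size (val x)); last by move=> /size_kids ->.
move=> x0; rewrite /kids size_filter count_map (@eq_count _ _ xpredT) => [|a].
  by rewrite count_predT size_enum_ord.
by rewrite /= size_neighbor; move/size0nil: x0 => ->.
Qed.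

Let kids_or_parent x y : y \in neighbors x -> y \in kids x \/ x \in kids y.
Proof.
move=> yx; have [yk|] := boolP (y \in kids x); first by left.
rewrite mem_filter yx andbT; move: yx => /mapP[a _ ->].
rewrite size_neighbor negbK => /eqP xa; right; rewrite mem_filter; apply/andP; split.
  by case: x xa => -[|c t] //= rs [->]; rewrite eqxx.
(* Moving along the same letter [a] again leads back from the parent to [x]. *)
by apply/mapP; exists a; rewrite ?mem_enum// neighborK.
Qed.

Definition regular_tree_rooting : rooting k (@neighbors k).
Proof.
apply: (@Rooting _ k (@neighbors k) (exist _ [::] isT) parent (fun x => size (val x)) kids) => //.
- by move=> x y; rewrite mem_filter => /andP[/eqP].
- by move=> x; rewrite filter_uniq// uniq_neighbors.
- exact: uniq_neighbors.
- by move=> x y; rewrite mem_filter => /andP[].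
Defined.

End RegularTree.

Theorem theorem1 (R : realType) (k j : nat)
    (hk : (0 < k)%N) (hj : (0 < j)%N) (hjk : (j <= k)%N) :
  [/\ FA_critical_density R k j = OFA_critical_density R k j,
      OFA_critical_density R k j = ptilde R k j,
      forall p : R, 0 <= p <= 1 -> p < ptilde R k j ->
        FA_zero_simple k j p /\ OFA_zero_simple k j p
    & 0 < ptilde R k j < 1 <-> (2 <= j <= k)%N].
Proof.
have FA := critical_densityE R (regular_tree_rooting k) hj hjk.
have OFA := critical_densityE R (rooted_tree_rooting k) hj hjk.
split=> [||p p01 pt|].
- by rewrite [LHS]FA [RHS]OFA.
- exact: OFA.
- split; first exact: (subcritical_simple (regular_tree_rooting k)).
  exact: (subcritical_simple (rooted_tree_rooting k)).
- by rewrite ptilde_gt0// ptilde_lt1// hjk andbT.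
Qed.
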